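(* Every measure from the Martin boundary of the Young–Fibonacci graph is ergodic. That is, the Plancherel measure and every measure $\mu_{w,\beta}$ with $w\in\mathbb{YF}_\infty^+$ and $\beta\in(0,1]$ are ergodic central measures on the space of infinite paths of the Young–Fibonacci graph.
   Context: Words. $\mathbb{YF}$ is the set of finite words over the alphabet $\{1,2\}$, including the empty word $\varepsilon$; $\mathbb{YF}_\infty$ is the set of left-infinite words $\ldots\alpha_2\alpha_1$ with $\alpha_i\in\{1,2\}$. For a word $x$, $|x|$ is the sum of its digits, $\#x$ its number of digits, $d(x)$ its number of digits $2$ (possibly $\infty$ for infinite words). $\mathbb{YF}_n=\{v\in\mathbb{YF}:|v|=n\}$. $xy$ denotes concatenation. Graph. The Young–Fibonacci graph has vertex set $\mathbb{YF}$, graded by rank $|x|$. The edges going up from $x$ (to rank $|x|+1$) lead to the words obtained from $x$ by either replacing the leftmost digit $1$ by $2$ (if there is a $1$), or inserting a digit $1$ somewhere to the left of the leftmost $1$ (anywhere if $x$ contains no $1$). For $x,y\in\mathbb{YF}$, $d(x,y)$ is the number of paths from $y$ down to $x$ (rank decreasing by $1$ at each step), with $d(x,y)=0$ if $|y|<|x|$. Function $g$. For a finite or infinite word $x$ and $1\le j\le d(x)$, $g(x,j)$ equals $1$ plus the sum of the digits standing to the right of the $j$-th digit $2$ of $x$ counted from the right. Function $\pi$. For a finite or infinite word $w$, $\pi(w)=\prod_{i:\,g(w,i)>1}\frac{g(w,i)-1}{g(w,i)}\in[0,1]$ (empty product is $1$). $\mathbb{YF}_\infty^+=\{w\in\mathbb{YF}_\infty:\pi(w)>0\}$.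 Function $h$. $h(x,y)$ is the number of digits of the longest common suffix of $x$ and $y$. Function $f$. $f(x,y,z)$ is defined for $x\in\mathbb{YF}$, $y\in\{0,\dots,|x|\}$, $z\in\{0,\dots,\#x\}$. For $z=0$: if $x=\alpha_1\cdots\alpha_n$ and there is $m\in\{0,\dots,n\}$ with $\alpha_{m+1}+\dots+\alpha_n=y$, then $$f(x,y,0)=(-1)^{n-m}\prod_{j=m+1}^{n}\frac1{\alpha_{m+1}+\dots+\alpha_j}\;\prod_{j=1}^{m}\frac{1}{\alpha_j+\dots+\alpha_m};$$ otherwise $f(x,y,0)=0$. For $z>0$, recursively: $f(x1,0,z)=f(x1,0,0)$; $f(x1,y,z)=f(x1,y,0)+f(x,y-1,z-1)$ if $y>0$; $f(x2,y,z)=\frac{f(x11,y,z+1)}{1-y}$ if $y\neq1$, and $f(x2,1,z)=0$. Measures. For $x\in\mathbb{YF}$, $w\in\mathbb{YF}_\infty$, $\beta\in(0,1]$, $$d'_\beta(x,w)=\sum_{i=0}^{|x|}\beta^i f(x,i,h(x,w))\prod_{j=1}^{d(w)}\frac{g(w,j)-i}{g(w,j)},\qquad \mu_{w,\beta}(v)=d(\varepsilon,v)\,d'_\beta(v,w)\quad(v\in\mathbb{YF})$$ (infinite products are limits of partial products). A central measure is a probability measure on the space of infinite paths $u_0u_1u_2\ldots$ in the graph with $u_0=\varepsilon$ and each $u_{i+1}$ above $u_i$, such that the measure of the set of paths with a given initial segment from $\varepsilon$ to $v$ depends only on $v$. For $w\in\mathbb{YF}_\infty^+$, $\beta\in(0,1]$,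 the central measure $\mu_{w,\beta}$ gives to each initial segment from $\varepsilon$ to $v$ the measure $\frac{\mu_{w,\beta}(v)}{d(\varepsilon,v)}$, so $\mu_{w,\beta}(v)$ is the measure of the set of paths through $v$. The Plancherel measure is the central measure for which the set of paths through $v\in\mathbb{YF}_n$ has measure $\frac{d(\varepsilon,v)^2}{n!}$. By a theorem of Goodman and Kerov, the Martin boundary of the Young–Fibonacci graph consists of the Plancherel measure and the measures $\mu_{w,\beta}$ with $w\in\mathbb{YF}_\infty^+$, $\beta\in(0,1]$. A central measure is ergodic if it is an extreme point of the convex set of central measures. *)

(* Defs.v *)
From HB Require Import structures.
From mathcomp Require Import all_boot all_order all_algebra.
From mathcomp Require Import zify.
From mathcomp Require Import all_classical all_reals all_analysis.
Set Implicit Arguments.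
Unset Strict Implicit.
Unset Printing Implicit Defensive.
Import Order.TTheory GRing.Theory Num.Theory.
Import numFieldNormedType.Exports.
Local Open Scope classical_set_scope.
Local Open Scope ring_scope.

Inductive digit := One | Two.

Definition bool_of_digit (a : digit) : bool := if a is Two then true else false.
Definition digit_of_bool (b : bool) : digit := if b then Two else One.
Lemma bool_of_digitK : cancel bool_of_digit digit_of_bool.
Proof. by case. Qed.
HB.instance Definition _ := Finite.copy digit (can_type bool_of_digitK).

Definition dval (a : digit) : nat := if a is Two then 2%N else 1%N.

(* Words are stored from right to left: the head of the list is the rightmost
   digit, so the word "x1" is [One :: x] and the suffixes of the word [x] are
   the lists [take k x]. A left-infinite word ... a_2 a_1 is the function
   sending i to a_(i+1). *)
Definition word := seq digit.
Definition infword := nat -> digit.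

Definition rank (x : word) : nat := (\sum_(a <- x) dval a)%N.

(* The words covering [x]. In both cases the condition on [i] says that the
   digits to the left of the place of the modification are all 2, i.e., that
   one inserts a 1 to the left of the leftmost 1 (anywhere if there is none),
   or that the digit turned from 1 into 2 is the leftmost 1. *)
Definition up (x : word) : seq word :=
  [seq take i x ++ One :: drop i x
     | i <- iota 0 (size x).+1 & all (pred1 Two) (drop i x)] ++
  [seq take i x ++ Two :: drop i.+1 x
     | i <- iota 0 (size x)
       & (nth Two x i == One) && all (pred1 Two) (drop i.+1 x)].

Definition edge : rel word := fun x y => y \in up x.

(* The upward paths with [n] edges starting at [x], without their initial
   vertex [x]; see [up_paths_uniq] and [mem_up_paths]. *)
Fixpoint up_paths (n : nat) (x : word) : seq (seq word) :=
  if n is m.+1 then flatten [seq [seq z :: p | p <- up_paths m z] | z <- up x]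
  else [:: [::]].

Lemma mem_up_paths n x p :
  (p \in up_paths n x) = (size p == n) && path edge x p.
Proof.
elim: n x p => [|n IHn] x [|y p] //=.
  by apply/negP => /flatten_mapP[z _ /mapP[]].
rewrite eqSS; apply/flatten_mapP/and3P.
  case=> z zx /mapP[q]; rewrite IHn => /andP[sq pq] [-> ->].
  by split.
case=> sp xy pp; exists y => //; apply/mapP; exists p => //.
by rewrite IHn sp.
Qed.

Lemma up_uniq x : uniq (up x).
Proof.
rewrite /up cat_uniq; apply/and3P; split.
- rewrite map_inj_in_uniq ?filter_uniq ?iota_uniq // => i j.
  rewrite !mem_filter !mem_iota /= !add0n !ltnS => /andP[ai si].
  move=> /andP[aj sj].
  wlog lt_ij : i j ai aj si sj / (i < j)%N.
    move=> wl; case: (ltngtP i j) => // ij e; first exact: wl.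
    by apply/esym/wl.
  move=> /(congr1 (fun s => nth Two s j)).
  rewrite !nth_cat !size_takel // ltnn subnn /= ltnNge (ltnW lt_ij) /=.
  rewrite -(ltn_predK (_ : (0 < j - i)%N)) ?subn_gt0 //= => e.
  have m : One \in drop i x.
    rewrite -e; apply: mem_nth; rewrite size_drop.
    by rewrite prednK ?subn_gt0 // leq_sub2r.
  by have := allP ai _ m.
- apply/hasPn => y /mapP[i]; rewrite mem_filter mem_iota.
  move=> /andP[_ /andP[_ si]] ->; apply/mapP => -[j].
  rewrite mem_filter mem_iota => /andP[_ /andP[_ sj]].
  rewrite !add0n ?ltnS in si sj.
  move=> /(congr1 size); rewrite !size_cat /= !size_takel ?(ltnW si) //.
  rewrite !size_drop => e; lia.
- rewrite map_inj_in_uniq ?filter_uniq ?iota_uniq // => i j.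
  rewrite !mem_filter !mem_iota /= !add0n => /andP[/andP[xi ai] si].
  move=> /andP[/andP[xj aj] sj] _.
  have key k l : nth Two x l == One -> (l < size x)%N ->
      all (pred1 Two) (drop k.+1 x) -> (l <= k)%N.
    move=> xl sl al; rewrite leqNgt; apply/negP => kl.
    have : nth Two (drop k.+1 x) (l - k.+1) == Two.
      apply: (allP al); apply: mem_nth.
      by rewrite size_drop ltn_sub2r // (leq_ltn_trans kl sl).
    by rewrite nth_drop subnKC // (eqP xl).
  by apply/eqP; rewrite eqn_leq (key j i) ?(key i j).
Qed.

Lemma up_paths_uniq n x : uniq (up_paths n x).
Proof.
elim: n x => //= n IHn x; elim: (up x) (up_uniq x) => //= y s IHs /andP[ys us].
rewrite cat_uniq IHs // map_inj_uniq ?IHn => [|p q [] //]; rewrite andbT /=.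
apply/hasPn => p /flatten_mapP[z zs /mapP[q _ ->]]; apply/mapP => -[r _ [zy _]].
by rewrite -zy zs in ys.
Qed.

Definition dpaths (x y : word) : nat :=
  if (rank y < rank x)%N then 0%N
  else count (fun p => last x p == y) (up_paths (rank y - rank x) x).

(* For a digit 2 at position [k] of [w] (positions being counted from 0 at the
   right end), [g w k] is the value of the function g at this 2. A product over
   the digits 2 of [w], finite or infinite in number, is the limit of the
   products over the positions [k < n] with [w k = Two]. *)
Definition g (w : infword) (k : nat) : nat := (1 + \sum_(i < k) dval (w i))%N.

Fixpoint h (x : word) (w : infword) : nat :=
  if x is a :: y then
    if a == w 0%N then (h y (fun n => w n.+1)).+1 else 0%N
  else 0%N.

Section functions.
Variable R : realType.

Definition pi_word (w : infword) : R :=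
  limn (fun n : nat => \prod_(k < n | (w k == Two) && (1 < g w k)%N)
                         (((g w k)%:R - 1) / (g w k)%:R : R)).

(* [f0 x y] is f(x,y,0). The number [k = n - m] is that of the digits of the
   suffix of [x] with sum [y]; it is unique since digits are positive. *)
Definition f0 (x : word) (y : nat) : R :=
  if [pick k : 'I_(size x).+1 | rank (take k x) == y] is Some k then
    (-1) ^+ k * (\prod_(i < k) (rank (drop i (take k x)))%:R^-1)
              * (\prod_(i < size x - k) (rank (take i.+1 (drop k x)))%:R^-1)
  else 0.

(* f(x1,y,z) in terms of [F] := f(x,.,.). *)
Definition f_cons1 (x : word) (F : nat -> nat -> R) (y z : nat) : R :=
  match z, y with
  | 0%N, _ => f0 (One :: x) y
  | _.+1, 0%N => f0 (One :: x) 0%N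
  | z'.+1, y'.+1 => f0 (One :: x) y + F y' z'
  end.

Fixpoint f (x : word) (y z : nat) {struct x} : R :=
  if z is 0%N then f0 x y else
  match x with
  | [::] => 0
  | One :: x' => f_cons1 x' (f x') y z
  | Two :: x' => if y == 1%N then 0
      else f_cons1 (One :: x') (f_cons1 x' (f x')) y z.+1 / (1 - y%:R)
  end.

(* The defining recursion of f. *)
Lemma f_z0 x y : f x y 0%N = f0 x y.
Proof. by case: x. Qed.

Lemma f_one0 x z : f (One :: x) 0%N z.+1 = f (One :: x) 0%N 0%N.
Proof. by []. Qed.

Lemma f_oneS x y z :
  f (One :: x) y.+1 z.+1 = f (One :: x) y.+1 0%N + f x y z.
Proof. by []. Qed.

Lemma f_two x y z : y != 1%N ->
  f (Two :: x) y z.+1 = f (One :: One :: x) y z.+2 / (1 - y%:R).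
Proof. by move=> /negbTE/= ->; case: y => [|[|y]] //; case: x. Qed.

Lemma f_two1 x z : f (Two :: x) 1%N z.+1 = 0.
Proof. by []. Qed.

Definition prod_g (w : infword) (i : nat) : R :=
  limn (fun n : nat => \prod_(k < n | w k == Two)
                         (((g w k)%:R - i%:R) / (g w k)%:R : R)).

Definition d' (b : R) (x : word) (w : infword) : R :=
  \sum_(i < (rank x).+1) b ^+ i * f x i (h x w) * prod_g w i.

Definition mu (w : infword) (b : R) (v : word) : R :=
  (dpaths [::] v)%:R * d' b v w.

End functions.

Record yfpath := YFPath {
  vertex :> nat -> word;
  vertex0 : vertex 0%N = [::];
  vertexS : forall n, edge (vertex n) (vertex n.+1) }.

Lemma edge_nseq1 n : edge (nseq n One) (nseq n.+1 One).
Proof.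
rewrite /edge /up mem_cat; apply/orP; left; apply/mapP; exists n.
  by rewrite mem_filter mem_iota size_nseq drop_oversize ?size_nseq //= leqnn.
rewrite take_oversize ?drop_oversize ?size_nseq // cats1.
by elim: n => //= n {1}->.
Qed.

HB.instance Definition _ := gen_eqMixin yfpath.
HB.instance Definition _ := gen_choiceMixin yfpath.
HB.instance Definition _ := isPointed.Build yfpath
  (@YFPath (fun n => nseq n One) erefl edge_nseq1).

(* The paths with initial segment [::], s_0, s_1, ... *)
Definition cylinder (s : seq word) : set yfpath :=
  [set u | forall i, (i < size s)%N -> u i.+1 = nth [::] s i].

Definition cylinders : set (set yfpath) :=
  [set cylinder s | s in [set s | path edge [::] s]].

Definition path_space := g_sigma_algebraType cylinders.

Definition through (v : word) : set path_space := [set u | exists n, vertex u n = v].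

Section measures.
Variable R : realType.
Implicit Types (P : probability path_space R).
Local Open Scope ereal_scope.

Definition central P : Prop := forall s t,
  path edge [::] s -> path edge [::] t -> last [::] s = last [::] t ->
  P (cylinder s) = P (cylinder t).

(* Extreme points of the convex set of central measures. Two measures are
   identified when they agree on all measurable sets. *)
Definition ergodic P : Prop := central P /\
  forall (P1 P2 : probability path_space R) (t : R),
    central P1 -> central P2 -> (0 < t < 1)%R ->
    (forall A, measurable A -> P A = t%:E * P1 A + (1 - t)%:E * P2 A) ->
    forall A, measurable A -> P1 A = P2 A.

Definition is_plancherel P : Prop := central P /\
  forall v, P (through v) =
            ((dpaths [::] v)%:R ^+ 2 / ((rank v)`!)%:R)%:E.

Definition is_mu (w : infword) (b : R) P : Prop := central P /\
  forall s, path edge [::] s ->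
    P (cylinder s) =
    (mu w b (last [::] s) / (dpaths [::] (last [::] s))%:R)%:E.

End measures.

(* Main.v *)
Require Import Defs.
From HB Require Import structures.
From mathcomp Require Import all_boot all_order all_algebra.
From mathcomp Require Import ring lra zify.
From mathcomp Require Import all_classical all_reals all_analysis.
Set Implicit Arguments.
Unset Strict Implicit.
Unset Printing Implicit Defensive.
Import Order.TTheory GRing.Theory Num.Theory.
Import numFieldNormedType.Exports.
Local Open Scope classical_set_scope.
Local Open Scope ring_scope.

(** A central measure is a nonnegative harmonic function phi with phi(eps) = 1.
    It is ergodic as soon as d(x, u_n) / d(eps, u_n) is close in mean to phi(x)
    along its random path u: a central measure that it dominates then has the
    same values.

    The kernel of a finite word v is the sum over i of f(x, i, h(x, v)) p_i(v),
    where p_i(v) is the product of (g - i) / g over the digits 2 of v: each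
    term is harmonic in x, and at the level of v the sum is, up to recursion on
    common suffixes, a divided difference of a polynomial of too small degree,
    so that only x = v survives.  The term i = 0 is the Plancherel function, and
    for the Plancherel measure the means of p_i, i > 0, tend to 0.

    The function d'_b(., w) is the limit of the kernels of the words 2...2 w_k,
    where w_k is the suffix of length k of w and the number of digits 2 is
    chosen so that they contribute a factor about b to p_1.  For i >= 4, the
    function p_i restricted to the words with suffix w_k is harmonic up to
    summable errors, so its mean over level n tends to b^i p_i(w).  By strict
    convexity, two values of i suffice to show that with high probability the
    suffix is w_k and the digits to the left of it contribute about b to p_1;
    then p_i(u_n) is close to b^i p_i(w) for all i. *)

(** * Words, edges and paths *)

(** The level means of a restricted p_i vary only because of words made of digits 2 to the left of
    some point of the suffix; there p_i is of order n^(-i/2). From i = 4 on this is at most of order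
    n^(-2), and these errors are summed by telescoping. The obvious index i = 1 is therefore out of
    reach. The means obtained are moments of a truncated variable: the contribution T to p_1 of the
    digits left of w_k, times the indicator of the suffix w_k, whose probability is not known
    beforehand. One moment cannot tell a loss of mass from a spread of T. Since t^j / j - t^i / i, i
    < j, has its strict minimum over t >= 0 at t = 1, two moments, taken at t = T / b, control both
    at once. A moment is informative only if p_i(w) is nonzero. This is where pi(w) > 0 enters,
    together with the condition that no digit 2 of w has g = i; as i and i + 1 are never both values
    of g, indices below 8 suffice. *)

Lemma rank_nil : rank [::] = 0%N.
Proof. by rewrite /rank big_nil. Qed.

Lemma rank_cons a x : rank (a :: x) = (dval a + rank x)%N.
Proof. by rewrite /rank big_cons. Qed.

Lemma rank_cat x y : rank (x ++ y) = (rank x + rank y)%N.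
Proof. by rewrite /rank big_cat. Qed.

Lemma rank_rcons x a : rank (rcons x a) = (rank x + dval a)%N.
Proof. by rewrite -cats1 rank_cat rank_cons rank_nil addn0. Qed.

Lemma rank_eq0 x : (rank x == 0%N) = (x == [::]).
Proof. by case: x => [|[] x]; rewrite ?rank_nil ?rank_cons. Qed.

Definition all_two (x : word) : bool := all (pred1 Two) x.

Lemma all_twoP x : all_two x -> x = nseq (size x) Two.
Proof. by move/all_pred1P. Qed.

(** A cover of [a :: x] keeps the rightmost digit and modifies [x], except for one that alters the
    right end, possible only if [x] has no digit 1. This recursion on the rightmost digit replaces
    the positional definition of [up] in all inductions. *)
Lemma perm_up a x :
  perm_eq (up (a :: x))
    ([seq a :: z | z <- up x] ++
     if all_two x then [:: if a is One then Two :: x else One :: Two :: x]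
     else [::]).
Proof.
have iotaS T (P : pred nat) (F : nat -> T) n :
    [seq F i | i <- iota 0 n.+1 & P i] =
    (if P 0%N then [:: F 0%N] else [::]) ++ [seq F i.+1 | i <- iota 0 n & P i.+1].
  rewrite /= (iotaDl 1 0) filter_map.
  by case: (P 0%N); rewrite /= -map_comp.
set A := [seq take i x ++ One :: drop i x
  | i <- iota 0 (size x).+1 & all (pred1 Two) (drop i x)].
set B := [seq take i x ++ Two :: drop i.+1 x
  | i <- iota 0 (size x) & (nth Two x i == One) && all (pred1 Two) (drop i.+1 x)].
have -> : up (a :: x) =
    ((if (a == Two) && all_two x then [:: [:: One, a & x]] else [::]) ++
     [seq a :: z | z <- A]) ++
    ((if (a == One) && all_two x then [:: Two :: x] else [::]) ++
     [seq a :: z | z <- B]).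
  rewrite /up [size (a :: x)]/= [X in X ++ _]iotaS [X in _ ++ X]iotaS /A /B -!map_comp.
  congr ((_ ++ _) ++ (_ ++ _)). by rewrite ?drop1.
rewrite (_ : up x = A ++ B) // map_cat; move: (map _ A) (map _ B) => sA sB.
case: a; rewrite /= -?catA ?perm_cat2l /=.
  by rewrite perm_catC.
by rewrite perm_sym catA perm_catC.
Qed.

Lemma up_nil : up [::] = [:: [:: One]].
Proof. by []. Qed.

Lemma mem_up a x y : (y \in up (a :: x)) =
  (y \in [seq a :: z | z <- up x]) ||
  (all_two x && (y == if a is One then Two :: x else One :: Two :: x)).
Proof.
rewrite (perm_mem (perm_up a x)) mem_cat; congr orb.
by case: (all_two x) => //=; rewrite inE.
Qed.

Lemma rank_up x y : y \in up x -> rank y = (rank x).+1.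
Proof.
elim: x y => [|a x IHx] y; first by rewrite up_nil inE => /eqP ->; rewrite rank_cons rank_nil.
rewrite mem_up => /orP[/mapP[z /IHx zx ->]|/andP[_ /eqP ->]].
  by rewrite !rank_cons zx addnS.
by case: a; rewrite !rank_cons.
Qed.

Fixpoint down (x : word) : seq word :=
  if x is a :: x' then
    [seq a :: z | z <- down x'] ++
    if all_two x' then [:: if a is One then x' else One :: x'] else [::]
  else [::].

Lemma mem_down a x y : (y \in down (a :: x)) =
  (y \in [seq a :: z | z <- down x]) ||
  (all_two x && (y == if a is One then x else One :: x)).
Proof. by rewrite mem_cat; case: (all_two x) => //=; rewrite inE. Qed.

Lemma cons_map_cons (a b : digit) (z : word) s :
  (a :: z \in [seq b :: t | t <- s]) = (a == b) && (z \in s).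
Proof.
apply/mapP/andP => [[t ts [-> ->]]|[/eqP -> zs]]; first by rewrite eqxx.
by exists z.
Qed.

Lemma nil_map_cons (b : digit) (s : seq word) :
  ([::] \in [seq b :: t | t <- s]) = false.
Proof. by apply/mapP => -[]. Qed.

Lemma down_upE x y : (y \in down x) = (x \in up y).
Proof.
elim: x y => [|a x IHx] y.
  case: y => [|b y] //; rewrite mem_up nil_map_cons /=.
  by case: b => //=; rewrite andbF.
rewrite mem_down; case: y => [|b y].
  rewrite nil_map_cons up_nil inE /=; case: a => /=; last by rewrite andbF.
  by case: x {IHx} => [|c x] //=; rewrite andbF.
rewrite mem_up !cons_map_cons IHx eq_sym.
case: a; case: b => //=; rewrite ?eqseq_cons ?eqxx /= ?andbF ?orbF //.
- suff -> : all_two x && (One :: y == x) = false by rewrite orbF.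
  by apply/negP => /andP[ax /eqP e]; rewrite -e in ax.
- by apply/andP/andP => -[ax /eqP e]; move: ax; rewrite -?e // e; split.
- by apply/andP/andP => -[ax /eqP e]; rewrite -?e ?e; split; rewrite // -?e -?e.
Qed.

(** Split by the leftmost digit: adding a digit there changes [twos_prod] and [pi_fin] by one factor
    depending only on the rank, which yields [psum_rec]. *)
Fixpoint words (n : nat) : seq word :=
  if n is n1.+1 then
    [seq rcons x One | x <- words n1] ++
    (if n1 is n2.+1 then [seq rcons x Two | x <- words n2] else [::])
  else [:: [::]].

Lemma wordsSS n : words n.+2 =
  [seq rcons x One | x <- words n.+1] ++ [seq rcons x Two | x <- words n].
Proof. by []. Qed.

Arguments words : simpl never.

Lemma nat_ind2 (P : nat -> Prop) :
  P 0%N -> P 1%N -> (forall n, P n -> P n.+1 -> P n.+2) -> forall n, P n.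
Proof.
move=> P0 P1 PS n; suff: P n /\ P n.+1 by case.
by elim: n => // n [Pn PSn]; split => //; apply: PS.
Qed.

Lemma mem_words n x : (x \in words n) = (rank x == n).
Proof.
have mapE a (y : word) b s :
    (rcons y a \in [seq rcons z b | z <- s]) = (a == b) && (y \in s).
  apply/mapP/andP => [[t ts /rcons_inj[-> ->]]|[/eqP -> zs]]; first by rewrite eqxx.
  by exists y.
have nilE b (s : seq word) : ([::] \in [seq rcons z b | z <- s]) = false.
  by apply/mapP => -[[]].
elim/nat_ind2: n x => [||n IH1 IH2] x.
- by rewrite inE rank_eq0.
- rewrite inE; case/lastP: x => [|x a]; first by rewrite rank_nil.
  rewrite rank_rcons eqseq_rcons -rank_eq0; case: a; rewrite /= ?andbF ?andbT.
    by rewrite addn1 eqSS.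
  by rewrite addn2 eqSS.
- rewrite wordsSS mem_cat; case/lastP: x => [|x a].
    by rewrite !nilE rank_nil.
  by rewrite !mapE IH1 IH2 rank_rcons; case: a => /=; lia.
Qed.

Lemma words_uniq n : uniq (words n).
Proof.
have inj a : injective (rcons ^~ a : word -> word) by move=> x y /rcons_inj[].
elim/nat_ind2: n => // n IH1 IH2; rewrite wordsSS cat_uniq !map_inj_uniq //.
rewrite IH1 IH2 andbT /=; apply/hasPn => z /mapP[x _ ->]; apply/mapP => -[y _].
by move=> /rcons_inj[].
Qed.

Lemma down_uniq x : uniq (down x).
Proof.
elim: x => //= a x IHx; rewrite cat_uniq map_inj_uniq ?IHx => [|y z []//] /=.
case: ifP => //= ax; rewrite orbF andbT; case: a.
  by apply/mapP => -[z _ xz]; rewrite xz in ax.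
by apply/mapP => -[].
Qed.

Lemma words_up_down (R : realType) n (G : word -> word -> R) :
  \sum_(u <- words n) \sum_(v <- up u) G u v =
  \sum_(v <- words n.+1) \sum_(u <- down v) G u v.
Proof.
transitivity (\sum_(u <- words n) \sum_(v <- words n.+1 | v \in up u) G u v).
  apply: eq_big_seq => u; rewrite mem_words => /eqP un.
  rewrite -[RHS]big_filter; apply: perm_big; apply: uniq_perm.
  - exact: up_uniq.
  - exact: filter_uniq (words_uniq _).
  - move=> v; rewrite mem_filter mem_words; case: (boolP (v \in up u)) => //=.
    by move/rank_up => ->; rewrite un eqxx.
rewrite (exchange_big_dep xpredT) //=; apply: eq_big_seq => v.
rewrite mem_words => /eqP vn.
rewrite -[LHS]big_filter; apply: perm_big; apply: uniq_perm.
- exact: filter_uniq (words_uniq _).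
- exact: down_uniq.
- move=> u; rewrite mem_filter mem_words down_upE.
  case: (boolP (v \in up u)) => //= /rank_up.
  by rewrite vn => -[->]; rewrite eqxx.
Qed.

Lemma dpaths_eq x y : rank x = rank y -> dpaths x y = (x == y).
Proof. by rewrite /dpaths => ->; rewrite ltnn subnn /= addn0. Qed.

Lemma dpaths_lt x y : (rank x < rank y)%N ->
  dpaths x y = (\sum_(z <- up x) dpaths z y)%N.
Proof.
move=> xy; rewrite {1}/dpaths ltnNge (ltnW xy) /= -(subnSK xy) /=.
rewrite count_flatten sumnE big_map big_map; apply: eq_big_seq => z zx.
rewrite /dpaths (rank_up zx) ltnNge xy /= count_map.
by apply: eq_count.
Qed.

Lemma sum_up_paths (R : realType) n x (F : word -> R) :
  \sum_(p <- up_paths n x) F (last x p) =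
  \sum_(v <- words (rank x + n)) (dpaths x v)%:R * F v.
Proof.
elim: n x => [|n IHn] x.
  rewrite addn0 big_seq1 /= (bigD1_seq x) ?mem_words ?words_uniq //=.
  rewrite dpaths_eq // eqxx mul1r big_seq_cond big1 ?addr0 // => v.
  rewrite mem_words => /andP[/eqP vx]; rewrite eq_sym => /negPf xv.
  by rewrite dpaths_eq // xv mul0r.
rewrite big_flatten /= big_map.
transitivity (\sum_(z <- up x) \sum_(v <- words (rank x + n.+1)) (dpaths z v)%:R * F v).
  apply: eq_big_seq => z zx; rewrite big_map /= IHn.
  by rewrite (rank_up zx) addSnnS.
rewrite exchange_big /=; apply: eq_big_seq => v; rewrite mem_words => /eqP vx.
by rewrite dpaths_lt ?vx -?addSnnS ?leq_addr // -mulr_suml natr_sum.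
Qed.

(** * The functions f(x, i, 0) *)

Section word_functions.
Variable R : realType.
Implicit Types (x v : word) (w : infword) (t : R).

(* The product of g - t over the digits 2; removing the rightmost digit lowers
   every g by the value of that digit. *)
Fixpoint twos_prod v t : R :=
  match v with
  | [::] => 1
  | One :: v' => twos_prod v' (t - 1)
  | Two :: v' => (1 - t) * twos_prod v' (t - 2)
  end.

(** [psi 0] is f(x, 0, 0), the Plancherel function d(eps, x) / |x|!. The offset [c] is the rank of
    the digits already removed at the right. *)
Fixpoint psi (c : nat) x : R :=
  if x is a :: x' then psi (c + dval a) x' / (c + dval a)%:R else 1.

Lemma psiE c x :
  psi c x = \prod_(i < size x) (c + rank (take i.+1 x))%:R^-1.
Proof.
elim: x c => [|a x IHx] c; first by rewrite big_ord0.
rewrite [LHS]/= [size _]/= big_ord_recl IHx mulrC /= take0 rank_cons rank_nil addn0.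
by congr (_ * _); apply: eq_bigr => i _; rewrite rank_cons addnA.
Qed.

Lemma take_rank_inj x (i j : nat) : (i <= size x)%N -> (j <= size x)%N ->
  rank (take i x) = rank (take j x) -> i = j.
Proof.
elim: x i j => [|a x IHx] [|i] [|j] //=; rewrite ?ltnS ?rank_nil ?rank_cons.
- by case: a.
- by case: a.
- by move=> ix jx /addnI /IHx ->.
Qed.

Lemma f0_some x k : (k <= size x)%N ->
  f0 R x (rank (take k x)) =
  (-1) ^+ k * (\prod_(i < k) (rank (drop i (take k x)))%:R^-1)
            * (\prod_(i < size x - k) (rank (take i.+1 (drop k x)))%:R^-1).
Proof.
move=> kx; rewrite /f0; case: pickP => [[l lx] /= /eqP|/(_ (Ordinal (kx : k < (size x).+1)%N))].
  by move=> /take_rank_inj -> //; rewrite -ltnS.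
by rewrite eqxx.
Qed.

Lemma f0_none x y : (forall k, (k <= size x)%N -> rank (take k x) != y) ->
  f0 R x y = 0.
Proof.
move=> xy; rewrite /f0; case: pickP => // -[l lx] /= ly.
by have := xy l; rewrite ly -ltnS => /(_ lx).
Qed.

Lemma f0_psi x : f0 R x 0 = psi 0 x.
Proof.
have := @f0_some x 0%N isT; rewrite take0 rank_nil => ->.
by rewrite big_ord0 expr0 !mul1r subn0 psiE drop0.
Qed.

Lemma f0_cons a x i : (0 < i)%N ->
  f0 R (a :: x) i =
  if (i < dval a)%N then 0 else - f0 R x (i - dval a) / i%:R.
Proof.
move=> i_gt0; case: ifP => ai.
  apply: f0_none => -[|k] _; first by rewrite take0 rank_nil eq_sym -lt0n.
  by rewrite /= rank_cons gtn_eqF // ltn_addr.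
move/negbT: ai; rewrite -leqNgt => ai.
have [k /eqP ki|no] :=
  pickP (fun k : 'I_(size x).+1 => rank (take k x) == (i - dval a)%N).
  have kx : (k <= size x)%N by rewrite -ltnS.
  have {1}-> : i = rank (take k.+1 (a :: x)) by rewrite /= rank_cons ki subnKC.
  rewrite f0_some // -ki f0_some // big_ord_recl drop0 subSS [drop k.+1 _]/=.
  rewrite exprS [take _ (_ :: _)]/= rank_cons ki subnKC //= mulN1r.
  move: (\prod_(_ < k) _) (\prod_(_ < size x - k) _) => A B.
  by ring.
rewrite (f0_none (x := x)) ?oppr0 ?mul0r.
  apply: f0_none => -[|k] /= kx; first by rewrite rank_nil eq_sym -lt0n.
  rewrite rank_cons; apply/eqP => e.
  by have := no (Ordinal (kx : (k < (size x).+1)%N)); rewrite /= -e addKn eqxx.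
by move=> k kx; apply/negbT/(no (Ordinal (kx : (k < (size x).+1)%N))).
Qed.

Lemma f0_cons_add a x i : (0 < i + dval a)%N ->
  f0 R (a :: x) (i + dval a) = - f0 R x i / (i + dval a)%:R.
Proof. by move=> ia; rewrite f0_cons // ltnNge leq_addl /= addnK. Qed.

Lemma f0_nil i : f0 R [::] i = (i == 0%N)%:R.
Proof.
case: i => [|i]; first by rewrite f0_psi.
by apply: f0_none => k _; rewrite take_oversize // rank_nil.
Qed.

Lemma f0_gt x i : (rank x < i)%N -> f0 R x i = 0.
Proof.
move=> xi; apply: f0_none => k _; rewrite ltn_eqF // (leq_ltn_trans _ xi) //.
by rewrite -{2}(cat_take_drop k x) rank_cat leq_addr.
Qed.

Lemma psi_rcons c x a :
  psi c (rcons x a) = psi c x / (c + rank (rcons x a))%:R.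
Proof.
elim: x c => [|b x IHx] c /=; first by rewrite rank_cons rank_nil addn0 mul1r.
by rewrite IHx rank_cons addnA mulrAC.
Qed.

(** At a suffix rank s_k of a word, f0 is the product of 1 / (s_j - s_k) over the other suffix ranks
    s_j. A new leftmost digit adds the node s, the rank of the new word, hence a factor 1 / (s - i);
    at i = s both sides are 0. *)
Lemma f0_rcons x a i :
  ((rank (rcons x a))%:R - i%:R) * f0 R (rcons x a) i = f0 R x i.
Proof.
elim: x i => [|b x IHx] [|i].
- by rewrite !f0_psi /= rank_cons rank_nil; case: a => /=; field.
- rewrite f0_nil /= rank_cons rank_nil addn0 f0_cons //; case: ifP => ia.
    by rewrite mulr0.
  rewrite !f0_nil /=; case: eqP; last by rewrite oppr0 !mul0r mulr0.
  move=> e; have -> : i.+1 = dval a by lia.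
  by rewrite subrr mul0r.
- rewrite subr0 !f0_psi psi_rcons add0n mulrCA divff ?mulr1 //.
  by rewrite pnatr_eq0 rank_eq0; case: (x).
- rewrite [rcons _ _]/= !f0_cons //; case: ifP => ib; first by rewrite mulr0.
  rewrite -IHx rank_cons; have {1}-> : i.+1 = (dval b + (i.+1 - dval b))%N by lia.
  rewrite !natrD; ring.
Qed.
End word_functions.

Ltac posnz := repeat (apply/andP; split);
  try (apply: lt0r_neq0; lra); try (apply: ltr0_neq0; lra).

(** * Harmonicity of x |-> f(x, i, h(x, w)) *)

Section harmonicity.
Variable R : realType.
Implicit Types (x v : word) (w : infword) (t : R).

Lemma sum_up_cons (F : word -> R) a x :
  \sum_(z <- up (a :: x)) F z = \sum_(z <- up x) F (a :: z) +
  (if all_two x then F (if a is One then Two :: x else One :: Two :: x) else 0).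
Proof.
rewrite (perm_big _ (perm_up a x)) big_cat big_map; congr (_ + _).
by case: ifP; rewrite ?big_seq1 ?big_nil.
Qed.

Lemma all_two_cons a x : all_two (a :: x) = (a == Two) && all_two x.
Proof. by []. Qed.

Lemma all_two_cons_ex x : all_two x -> x = [::] \/ exists2 y, x = Two :: y & all_two y.
Proof. by case: x => [|[] x] //=; [left | move=> ax; right; exists x]. Qed.

(** The correction is what the induction produces for c > 0; it vanishes at c = 0, which gives the
    harmonicity of the Plancherel function. *)
Lemma psi_up x c : \sum_(z <- up x) psi R c z =
  psi R c x - (if all_two x then c%:R / c.+1%:R * psi R c.+1 x else 0).
Proof.
have nS n : n.+1%:R = n%:R + 1 :> R by rewrite natr1.
elim: x c => [|a x IHx] c.
  rewrite up_nil big_seq1 /= mul1r mulr1 addn1.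
  by rewrite -[in RHS]natr1; field; rewrite natr1.
rewrite sum_up_cons /= -mulr_suml IHx.
case: a => /=; case: ifP => /= ax; rewrite ?addr0 ?subr0 //.
- rewrite !(addn1, addn2) !nS; have := ler0n R c => c0; field; posnz.
- rewrite !(addn1, addn2, addSn, addnS) !nS; have := ler0n R c => c0; field; posnz.
Qed.

Lemma f0_all_two_shift x i : f0 R (Two :: x) i.+2 = - f0 R x i / i.+2%:R.
Proof. by rewrite f0_cons //= subn2. Qed.

(** For i > 0 harmonicity can fail only at the words 2...2; the terms that the recursion of f adds
    for z > 0 make up for this in [f_up]. *)
Lemma f0_up x i : \sum_(z <- up x) f0 R z i =
  f0 R x i - (if all_two x && (0 < i)%N then f0 R x i.-1 else 0).
Proof.
have nS n : n.+1%:R = n%:R + 1 :> R by rewrite natr1.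
elim: x i => [|a x IHx] [|i].
- by rewrite up_nil big_seq1 !f0_psi /= !divr1 subr0.
- rewrite up_nil big_seq1 f0_cons //= subn1 /= !f0_nil /=.
  by case: i => [|i] /=; rewrite ?divr1 ?sub0r ?oppr0 ?mul0r.
- rewrite andbF subr0 f0_psi; under eq_bigr do rewrite f0_psi.
  by rewrite psi_up mul0r; case: ifP; rewrite ?mul0r subr0.
- rewrite sum_up_cons; case: a.
    under eq_bigr do rewrite f0_cons // subn1.
    rewrite -mulr_suml sumrN IHx /= subr0 [in RHS]f0_cons //= subn1 /=.
    case: (boolP (all_two x)) => /= ax; last by rewrite subr0 addr0.
    case: i => [|i] /=; first by rewrite f0_cons //= subr0 addr0.
    by rewrite f0_all_two_shift; ring.
  case: i => [|i].
    rewrite big1 ?add0r => [|z _]; last by rewrite f0_cons.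
    rewrite [in RHS]f0_cons //= sub0r andbT; case: ifP => [_|_].
      by rewrite f0_cons //= subnn divr1.
    by rewrite oppr0.
  under eq_bigr do rewrite f0_all_two_shift.
  rewrite -mulr_suml sumrN IHx /= andbT f0_all_two_shift.
  case: (boolP (all_two x)) => /= ax; last by rewrite !subr0 addr0.
  rewrite f0_cons //= subn1 /=; case: i => [|i] /=.
    by rewrite f0_cons // !(subr0, oppr0, mul0r).
  by rewrite f0_all_two_shift !nS; have := ler0n R i => i0; field; posnz.
Qed.

Lemma f_one_cons x i z : f R (One :: x) i z.+1 =
  f0 R (One :: x) i + (if i is i'.+1 then f R x i' z else 0).
Proof. by case: i => [|i]; rewrite ?f_oneS // f_one0 f_z0 addr0. Qed.

(** Unfolding the detour through x11 leaves only the difference between f and f0 at x, which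
    vanishes wherever these agree, in particular on words 2...2. *)
Lemma f_two_cons x i z : i != 1%N -> f R (Two :: x) i z.+1 =
  f0 R (Two :: x) i +
  (if i is i'.+2 then (f R x i' z - f0 R x i') / (1 - i%:R) else 0).
Proof.
move=> i1; rewrite f_two // !f_one_cons; case: i i1 => [|[|i]] // _.
  by rewrite !f0_psi /= !addr0 addn1 addn2; field.
rewrite f_one_cons f0_all_two_shift !f0_cons //= ?subn1 /=.
have nS n : n.+1%:R = n%:R + 1 :> R by rewrite natr1.
by rewrite !nS; have := ler0n R i => i0; field; posnz.
Qed.

Lemma f_gt x i z : (rank x < i)%N -> f R x i z = 0.
Proof.
elim: x i z => [|a x IHx] i [|z] xi; rewrite ?f_z0 ?f0_gt //.
rewrite rank_cons in xi; case: a xi => xi; rewrite [dval _]/= in xi.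
  rewrite f_one_cons f0_gt ?rank_cons // add0r.
  by case: i xi => // i xi; rewrite IHx.
case: i xi => [|[|i]] // xi.
rewrite f_two_cons // f0_gt ?rank_cons // add0r.
by rewrite IHx ?f0_gt ?subrr ?mul0r //; lia.
Qed.

Definition shift (w : infword) : infword := fun n => w n.+1.

Lemma h_cons a x w :
  h (a :: x) w = if a == w 0%N then (h x (shift w)).+1 else 0%N.
Proof. by []. Qed.

Lemma g_shift w k : g w k.+1 = (dval (w 0%N) + g (shift w) k)%N.
Proof. by rewrite /g big_ord_recl addnCA. Qed.

Lemma g0 w : g w 0 = 1%N.
Proof. by rewrite /g big_ord0. Qed.

(** No factor (g - i) / g of p_i vanishes. For a finite word, the other indices i contribute nothing
    to the kernel. *)
Definition avoids w (i : nat) := forall k, w k = Two -> g w k != i.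

Lemma avoids_shift w i : avoids w (dval (w 0%N) + i) -> avoids (shift w) i.
Proof. by move=> wi k /(wi k.+1); rewrite g_shift eqn_add2l. Qed.

Lemma f_cons_neq a x w i : a != w 0%N ->
  f R (a :: x) i (h (a :: x) w) = f0 R (a :: x) i.
Proof. by rewrite h_cons => /negbTE ->; rewrite f_z0. Qed.

(** By induction the difference in [f_two_cons] is zero; i = 1 cannot occur while the digits agree,
    as a rightmost 2 of w has g = 1. *)
Lemma f_all_two x w i : avoids w i -> all_two x ->
  f R x i (h x w) = f0 R x i.
Proof.
elim: x w i => [|a x IHx] w i wi; first by rewrite f_z0.
case/all_two_cons_ex => // -[y [-> <-{y}] ax].
have [w0|w0] := eqVneq Two (w 0%N); last exact: f_cons_neq.
rewrite h_cons w0 eqxx -w0 f_two_cons; last first.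
  by rewrite eq_sym -(g0 w); apply: wi.
case: i wi => [|[|i]] wi; rewrite ?addr0 //.
rewrite IHx ?subrr ?mul0r ?addr0 //.
by apply: avoids_shift; rewrite -w0.
Qed.

(** Induction on the rightmost digit. What f0 lacks at words 2...2 is restored either by the new
    cover, whose rightmost digit may match w, or by the difference in [f_two_cons]. *)
Lemma f_up x w i : avoids w i ->
  \sum_(z <- up x) f R z i (h z w) = f R x i (h x w).
Proof.
elim: x w i => [|a x IHx] w i wi.
  rewrite up_nil big_seq1 f_z0 f0_nil.
  have [w0|w0] := eqVneq One (w 0%N).
    rewrite h_cons w0 eqxx -w0 f_one_cons [h [::] _]/=.
    case: i {wi} => [|i]; first by rewrite f0_psi /= divr1 addr0.
    by rewrite f_z0 f0_cons //= subn1 /= !f0_nil; case: i => [|i] /=;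
       rewrite ?divr1 ?addNr ?oppr0 ?mul0r ?addr0.
  rewrite f_cons_neq //; case: i wi => [|[|i]] wi; first by rewrite f0_psi /= divr1.
    have := wi 0%N; rewrite g0; case: (w 0%N) w0 => // _ /(_ erefl).
    by rewrite eqxx.
  by rewrite f0_cons //= subn1 f0_nil oppr0 mul0r.
rewrite sum_up_cons; have [aw|aw] := eqVneq a (w 0%N); last first.
  under eq_bigr => z _ do rewrite f_cons_neq //.
  rewrite f_cons_neq //.
  have := f0_up (a :: x) i; rewrite sum_up_cons => /(canRL (addrK _)) ->.
  rewrite all_two_cons; case: (boolP (all_two x)) => ax; last first.
    by rewrite andbF !subr0 addr0.
  rewrite andbT; case: a aw => aw.
    by rewrite f_all_two //= subr0 subrK.
  have w1 : One = w 0%N by case: (w 0%N) aw.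
  (* The cover that inserts a 1 at the right end matches the digit 1 of w, so its f exceeds f0 by f0
     at [Two :: x] with index i - 1: exactly the term missing in [f0_up]. *)
  rewrite h_cons w1 eqxx -w1 f_one_cons.
  case: i wi => [|i] wi; first by rewrite /= subr0 addr0 subrK.
  rewrite f_all_two //; last by apply: avoids_shift; rewrite -w1.
  by rewrite /=; ring.
have hc z : h (a :: z) w = (h z (shift w)).+1 by rewrite h_cons aw eqxx.
rewrite hc; under eq_bigr do rewrite hc.
have f0u := f0_up (a :: x) i; rewrite sum_up_cons all_two_cons in f0u.
case: a aw hc f0u => aw hc f0u.
  rewrite andFb subr0 in f0u.
  rewrite f_one_cons -f0u.
  under eq_bigr do rewrite f_one_cons.
  rewrite big_split /=.
  have -> : (if all_two x then f R (Two :: x) i (h (Two :: x) w) else 0) =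
            (if all_two x then f0 R (Two :: x) i else 0).
    by case: ifP => // ax; rewrite f_all_two.
  rewrite addrAC; congr (_ + _).
  case: i wi {f0u} => [|i] wi; first by rewrite big1.
  by rewrite IHx //; apply: avoids_shift; rewrite -aw.
have i1 : i != 1%N by rewrite eq_sym -(g0 w); apply: wi.
rewrite f_two_cons //; under eq_bigr do rewrite f_two_cons //.
rewrite big_split /=.
have -> : (if all_two x then f R [:: One, Two & x] i (h [:: One, Two & x] w) else 0) =
          (if all_two x then f0 R [:: One, Two & x] i else 0).
  by case: ifP => // ax; rewrite f_cons_neq // -aw.
rewrite addrAC f0u andTb.
case: i wi i1 {f0u} => [|[|i]] // wi _; first by rewrite big1 // andbF subr0.
have wi' : avoids (shift w) i by apply: avoids_shift; rewrite -aw.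
(* The failure of f0 at [x], divided by 1 - i for the full index i, cancels the failure of f0 at
   [Two :: x]. *)
rewrite -mulr_suml sumrB IHx // f0_up.
case: (boolP (all_two x)) => ax /=; last by rewrite !subr0.
rewrite (f_all_two wi' ax) subrr.
case: i {wi wi'} => [|i]; rewrite !f0_cons //=; first by rewrite !(subr0, subrr, mul0r, addr0).
rewrite !subn2 /=.
have nS n : n.+1%:R = n%:R + 1 :> R by rewrite natr1.
by rewrite !nS; have := ler0n R i => i0; field; posnz.
Qed.
End harmonicity.

(** * The Martin kernel of finite words *)

Section finite_identity.
Variable R : realType.
Implicit Types (x v : word) (w : infword) (t : R).

Lemma twos_prod_rcons v a t : twos_prod (rcons v a) t =
  twos_prod v t * (if a is Two then (rank v).+1%:R - t else 1).
Proof.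
elim: v t => [|b v IHv] t /=; first by case: a; rewrite /= ?rank_nil ?mulr1 ?mul1r.
case: b; rewrite !IHv rank_cons /=.
  case: a {IHv}; rewrite ?mulr1 //.
  by congr (_ * _); rewrite add1n -!natr1; ring.
case: a {IHv}; rewrite ?mulr1 //.
by rewrite -mulrA; congr (_ * (_ * _)); rewrite add2n -!natr1; ring.
Qed.

Lemma twos_prod_cat v u t : twos_prod (v ++ u) t = twos_prod v t * twos_prod u (t - (rank v)%:R).
Proof.
elim: v t => [|[] v IHv] t /=; first by rewrite rank_nil subr0 mul1r.
  by rewrite IHv rank_cons natrD opprD addrA.
by rewrite IHv rank_cons mulrA [in RHS]natrD; congr (_ * twos_prod _ _); rewrite /=; ring.
Qed.

Lemma twos_prod_ge1 v t : t <= 0 -> 1 <= twos_prod v t.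
Proof.
elim: v t => [|[] v IHv] t t0 //=; first by apply: IHv; lra.
by rewrite -[leLHS]mulr1 ler_pM ?IHv //; lra.
Qed.

Lemma twos_prod_gt0 v t : t <= 0 -> 0 < twos_prod v t.
Proof. by move=> /(twos_prod_ge1 v) q1; rewrite (lt_le_trans ltr01). Qed.

Definition twos x : nat := count (pred1 Two) x.

Lemma rank_twos x : rank x = (size x + twos x)%N.
Proof. by elim: x => [|[] x IHx]; rewrite ?rank_nil // rank_cons IHx /=; lia. Qed.

Lemma twos_le_size x : (twos x <= size x)%N.
Proof. exact: count_size. Qed.

Lemma twos_prod_prod v : exists2 l : seq R, size l = twos v &
  forall t, twos_prod v t = \prod_(c <- l) (c - t).
Proof.
elim: v => [|[] v [l sl lE]].
- by exists [::] => // t; rewrite big_nil.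
- exists [seq c + 1 | c <- l] => [|t]; first by rewrite size_map.
  by rewrite /= lE big_map; apply: eq_bigr => c _; ring.
- exists (1 :: [seq c + 2 | c <- l]) => [|t]; first by rewrite /= size_map sl.
  rewrite big_cons /= lE big_map; congr (_ * _).
  by apply: eq_bigr => c _; ring.
Qed.

(* For the suffix ranks s_0 < ... < s_N of x, this is up to sign the divided
   difference of q at s_0, ..., s_N, so that it vanishes on polynomials of
   degree less than N. *)
Definition ddiff x (q : R -> R) : R := \sum_(i < (rank x).+1) f0 R x i * q i%:R.

Lemma ddiff_widen x n q : (rank x <= n)%N ->
  ddiff x q = \sum_(i < n.+1) f0 R x i * q i%:R.
Proof.
move=> xn; rewrite /ddiff (big_ord_widen _ (fun i => f0 R x i * q i%:R) (xn : (_ < n.+1)%N)).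
rewrite big_mkcond; apply: eq_bigr => i _; case: ifP => // /negbT.
by rewrite -leqNgt => /f0_gt ->; rewrite mul0r.
Qed.

Lemma eq_ddiff x q1 q2 : q1 =1 q2 -> ddiff x q1 = ddiff x q2.
Proof. by move=> e; apply: eq_bigr => i _; rewrite e. Qed.

Lemma ddiffB x q1 q2 : ddiff x (fun t => q1 t - q2 t) = ddiff x q1 - ddiff x q2.
Proof. by rewrite -sumrB; apply: eq_bigr => i _; rewrite mulrBr. Qed.

Lemma ddiffZ x c q : ddiff x (fun t => c * q t) = c * ddiff x q.
Proof. by rewrite /ddiff mulr_sumr; apply: eq_bigr => i _; rewrite mulrCA. Qed.

Lemma ddiff_rcons x a q :
  ddiff (rcons x a) (fun t => ((rank (rcons x a))%:R - t) * q t) = ddiff x q.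
Proof.
rewrite [RHS](@ddiff_widen _ (rank (rcons x a))) ?rank_rcons ?leq_addr //.
rewrite /ddiff -rank_rcons; apply: eq_bigr => i _.
by rewrite mulrCA mulrA f0_rcons.
Qed.

Lemma ddiff_cons a x q :
  ddiff (a :: x) (fun t => t * q t) = - ddiff x (fun t => q (t + (dval a)%:R)).
Proof.
rewrite /ddiff rank_cons -addnS big_split_ord /= big1 ?add0r => [|i _]; last first.
  case: i => -[|i] /= ia; first by rewrite mul0r mulr0.
  by rewrite f0_cons // ia mul0r.
rewrite -sumrN; apply: eq_bigr => i _.
have a0 : (0 < dval a)%N by case: a.
rewrite addnC f0_cons_add ?addn_gt0 ?a0 ?orbT //.
rewrite mulrA divfK ?mulNr ?natrD //.
by rewrite -natrD pnatr_eq0 addn_eq0 negb_and -!lt0n a0 orbT.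
Qed.

(** Write the rank s of x as (s - t) + t: the factor s - t deletes the node s, the factor t deletes
    the node 0 with a change of sign. The two divided differences of 1 that remain cancel for a
    single digit and vanish by induction otherwise. *)
Lemma ddiff1 x : (0 < size x)%N -> ddiff x (fun=> 1) = 0.
Proof.
have [n] := ubnP (size x); elim: n x => // n IHn x; rewrite ltnS => xn x0.
have : (rank x)%:R * ddiff x (fun=> 1) = 0.
  rewrite -ddiffZ.
  have -> : ddiff x (fun=> (rank x)%:R * 1) =
            ddiff x (fun t => ((rank x)%:R - t) * 1) - - ddiff x (fun t => t * 1).
    rewrite opprK -[X in _ + X]opprK -[- ddiff _ _]mulN1r -ddiffZ -ddiffB.
    by apply: eq_ddiff => t; ring.
  case/lastP: x xn x0 => // y a; rewrite size_rcons => yn _.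
  rewrite ddiff_rcons; case: y yn => [|b y] yn.
    by rewrite ddiff_cons opprK addrN.
  rewrite rcons_cons ddiff_cons opprK (IHn (b :: y)) //.
  by rewrite (IHn (rcons y a)) ?size_rcons // subr0.
move/eqP; rewrite mulf_eq0 pnatr_eq0 rank_eq0 => /orP[/eqP x_nil|/eqP //].
by rewrite x_nil in x0.
Qed.

Lemma ddiff_prod x (l : seq R) : (size l < size x)%N ->
  ddiff x (fun t => \prod_(c <- l) (c - t)) = 0.
Proof.
elim: l x => [|c l IHl] x.
  by move/ddiff1 => <-; apply: eq_ddiff => t; rewrite big_nil.
case/lastP: x => // y a; rewrite size_rcons ltnS /= => ly.
pose s : R := (rank (rcons y a))%:R; pose q (t : R) := \prod_(c <- l) (c - t).
(* By c - t = (s - t) - (s - c), the first part loses a node along with the degree, the second has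
   lower degree. *)
have -> : ddiff (rcons y a) (fun t => \prod_(d <- c :: l) (d - t)) =
    ddiff (rcons y a) (fun t => (s - t) * q t) - (s - c) * ddiff (rcons y a) q.
  rewrite -ddiffZ -ddiffB; apply: eq_ddiff => t; rewrite big_cons -/(q t); ring.
by rewrite ddiff_rcons !IHl ?mulr0 ?subr0 // size_rcons ltnS ltnW.
Qed.

Lemma ddiff_twos_prod x v t0 : (twos v < size x)%N ->
  ddiff x (fun t => twos_prod v (t - t0)) = 0.
Proof.
have [l <- lE] := twos_prod_prod v; rewrite -(size_map (+%R t0)) => /ddiff_prod <-.
by apply: eq_ddiff => t; rewrite lE big_map; apply: eq_bigr => c _; ring.
Qed.

(** Padding by 1 creates no digit 2, hence no new factor. As long as |x| <= |v|, h(x, [pad v]) is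
    h(x, v). *)
Definition pad v : infword := fun k => nth One v k.

(** The kernel of v multiplied by d(eps, v) = [twos_prod v 0]; it is d(x, v) when |x| <= |v|, by
    [dpaths_martin]. *)
Definition martin x v : R :=
  \sum_(i < (rank x).+1) f R x i (h x (pad v)) * twos_prod v i%:R.

Lemma martin_neq a b x v : a != b ->
  martin (a :: x) (b :: v) = ddiff (a :: x) (twos_prod (b :: v)).
Proof. by move=> ab; apply: eq_bigr => i _; rewrite f_cons_neq. Qed.

Lemma martin_one x v : martin (One :: x) (One :: v) =
  ddiff (One :: x) (twos_prod (One :: v)) + martin x v.
Proof.
have hE : h (One :: x) (pad (One :: v)) = (h x (pad v)).+1 by [].
rewrite /martin hE; under eq_bigr do rewrite f_one_cons mulrDl.
rewrite big_split /=; congr (_ + _).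
rewrite rank_cons add1n big_ord_recl mul0r add0r; apply: eq_bigr => i _ /=.
by congr (_ * twos_prod _ _); rewrite -natr1; ring.
Qed.

(** The factor 1 - t of the rightmost 2 of v cancels the denominators 1 - i of [f_two_cons]. The
    divided difference subtracted there cancels the part of the f0 terms that carries the factor
    t. *)
Lemma martin_two x v : martin (Two :: x) (Two :: v) =
  ddiff (Two :: x) (fun t => twos_prod v (t - 2)) + martin x v.
Proof.
have hE : h (Two :: x) (pad (Two :: v)) = (h x (pad v)).+1 by [].
pose F (i : nat) : R := if i is i'.+2 then
  (f R x i' (h x (pad v)) - f0 R x i') * twos_prod v i'%:R else 0.
have -> : martin (Two :: x) (Two :: v) =
    ddiff (Two :: x) (twos_prod (Two :: v)) + \sum_(i < (rank (Two :: x)).+1) F i.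
  rewrite -big_split /= /martin; apply: eq_bigr => i _; rewrite hE.
  move: (nat_of_ord i) => {}i; rewrite -/(twos_prod (Two :: v) i%:R).
  have [->|i1] := eqVneq i 1%N.
    by rewrite f_two1 mul0r /F [twos_prod (Two :: v) _]/= subrr mul0r mulr0 addr0.
  rewrite f_two_cons // mulrDl; congr (_ + _); rewrite /F.
  case: i i1 => [|[|i]] // _; first by rewrite mul0r.
  rewrite [twos_prod (Two :: v) _]/=.
  have -> : i.+2%:R - 2 = i%:R :> R by rewrite -addn2 natrD addrK.
  have e : 1 - i.+2%:R != 0 :> R.
    by have := ler0n R i => i0; rewrite -addn2 natrD; posnz.
  by rewrite mulrA divfK.
rewrite rank_cons -addnS big_split_ord /= big_ord_recl big_ord1 !add0r.
have -> : \sum_(i < (rank x).+1) F (2 + i)%N = martin x v - ddiff x (twos_prod v).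
  by rewrite -sumrB; apply: eq_bigr => i _; rewrite add2n /F mulrBl.
have -> : ddiff (Two :: x) (twos_prod (Two :: v)) =
    ddiff (Two :: x) (fun t => twos_prod v (t - 2)) + ddiff x (twos_prod v).
  have -> : ddiff x (twos_prod v) = ddiff x (fun t => twos_prod v (t + 2 - 2)).
    by apply: eq_ddiff => t; rewrite addrK.
  rewrite -[ddiff x _]opprK -(ddiff_cons Two x (fun t => twos_prod v (t - 2))) -ddiffB.
  by apply: eq_ddiff => t /=; ring.
ring.
Qed.

(** A word of rank r has at least r / 2 digits, of which at most r / 2 are 2. So in each case the
    polynomial has degree less than the number of digits of the word, and the divided difference
    vanishes; only a complete match of the digits leaves the value 1. *)
Lemma martin_eq_rank x v : rank x = rank v -> martin x v = (x == v)%:R.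
Proof.
elim: v x => [|b v IHv] [|a x] xv.
- by rewrite /martin rank_nil big_ord1 f_z0 f0_psi /= mulr1.
- by move/eqP: xv; rewrite rank_nil rank_eq0.
- by move/esym/eqP: xv; rewrite rank_nil rank_eq0.
- move: xv (twos_le_size x) (twos_le_size v); rewrite !rank_cons !rank_twos.
  rewrite eqseq_cons; case: a; case: b => /= xv xs vs.
  + rewrite martin_one IHv ?rank_twos; last by lia.
    by rewrite (@ddiff_twos_prod (One :: x) v 1) ?add0r //=; lia.
  + rewrite martin_neq //; have := @ddiff_twos_prod (One :: x) (Two :: v) 0.
    under eq_ddiff do rewrite subr0.
    by apply => /=; lia.
  + rewrite martin_neq //; have := @ddiff_twos_prod (Two :: x) (One :: v) 0.
    under eq_ddiff do rewrite subr0.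
    by apply => /=; lia.
  + rewrite martin_two IHv ?rank_twos; last by lia.
    by rewrite ddiff_twos_prod ?add0r //=; lia.
Qed.

Lemma pad_avoids v (i : nat) : twos_prod v (i%:R : R) != 0 -> avoids (pad v) i.
Proof.
elim: v i => [|a v IHv] i qi k; first by rewrite /pad nth_nil.
case: k => [|k] wk.
  rewrite g0; apply: contraNneq qi => <-; move: wk; rewrite /pad /= => ->.
  by rewrite /= subrr mul0r.
rewrite g_shift; have [ai|ai] := leqP (dval a) i; last first.
  by rewrite neq_ltn; apply/orP; right; rewrite ltn_addr.
rewrite -(subnKC ai) eqn_add2l; apply: (IHv (i - dval a)%N) => //.
move: qi; case: a {wk} ai => /= ai; first by rewrite natrB.
by rewrite mulf_eq0 negb_or natrB // => /andP[].
Qed.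

Lemma martin_up x v : \sum_(z <- up x) martin z v = martin x v.
Proof.
have -> : \sum_(z <- up x) martin z v =
    \sum_(z <- up x) \sum_(i < (rank x).+2) f R z i (h z (pad v)) * twos_prod v i%:R.
  by apply: eq_big_seq => z /rank_up zx; rewrite /martin zx.
rewrite exchange_big /=.
have fi i : \sum_(z <- up x) f R z i (h z (pad v)) * twos_prod v i%:R =
    f R x i (h x (pad v)) * twos_prod v i%:R.
  (* Either p_i(v) = 0 and both sides vanish, or no g equals i and [f_up] applies. *)
  rewrite -mulr_suml; have [->|qi] := eqVneq (twos_prod v (i%:R : R)) 0; first by rewrite !mulr0.
  by rewrite (@f_up _ x _ _ (pad_avoids qi)).
under eq_bigr do rewrite fi.
by rewrite big_ord_recr /= f_gt ?mul0r ?addr0.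
Qed.

(** Both sides satisfy the same recursion over the covers of x below the level of v, and they agree
    at that level. *)
Lemma dpaths_martin x v : (rank x <= rank v)%N -> (dpaths x v)%:R = martin x v.
Proof.
move=> xv; have [n] := ubnP (rank v - rank x)%N.
elim: n x xv => // n IHn x; rewrite leq_eqVlt => /orP[/eqP xv _|xv].
  by rewrite martin_eq_rank // dpaths_eq.
move=> vx; rewrite dpaths_lt // -martin_up natr_sum; apply: eq_big_seq => z zx.
by rewrite IHn // (rank_up zx) //; lia.
Qed.

Lemma dpaths_nil v : (dpaths [::] v)%:R = twos_prod v 0 :> R.
Proof.
rewrite dpaths_martin ?rank_nil // /martin rank_nil big_ord1 f_z0 f0_psi.
by rewrite mul1r.
Qed.
End finite_identity.

(** * Central measures and harmonic functions *)

Section path_measures.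
Variable R : realType.
Implicit Types (x v z : word) (s : seq word) (P : probability path_space R).

Definition harmonic_fun (phi : word -> R) := forall x, \sum_(z <- up x) phi z = phi x.

Definition distributed_by (phi : word -> R) P := forall s, path edge [::] s ->
  P (cylinder s) = (phi (last [::] s))%:E.

Lemma measurable_cylinder s : path edge [::] s ->
  measurable (cylinder s : set path_space).
Proof. by move=> ps; apply: sub_sigma_algebra; exists s. Qed.

Lemma cylinder_nil : cylinder [::] = setT.
Proof. by apply/seteqP; split. Qed.

Lemma ex_path_to v : exists2 s, path edge [::] s & last [::] s = v.
Proof.
have : (0 < dpaths [::] v)%N by rewrite -(ltr_nat R) dpaths_nil twos_prod_gt0.
rewrite /dpaths rank_nil /= -has_count => /hasP[s].
by rewrite mem_up_paths => /andP[_ ps] /eqP <-; exists s.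
Qed.

Lemma cylinder_vertex s (u : yfpath) : cylinder s u -> u (size s) = last [::] s.
Proof.
case/lastP: s => [|s z]; first by rewrite vertex0.
by rewrite size_rcons last_rcons => /(_ (size s)) ->; rewrite ?size_rcons // nth_rcons ltnn eqxx.
Qed.

Lemma cylinder_rcons s z (u : yfpath) :
  cylinder (rcons s z) u <-> cylinder s u /\ u (size s).+1 = z.
Proof.
split=> [us|[us uz] i].
  split; last by rewrite us ?size_rcons // nth_rcons ltnn eqxx.
  by move=> i si; rewrite us ?size_rcons 1?ltnW // nth_rcons si.
rewrite size_rcons ltnS leq_eqVlt nth_rcons => /orP[/eqP ->|si].
  by rewrite ltnn eqxx.
by rewrite si us.
Qed.

Lemma measure_bigcup_seq d (T : measurableType d) (m : {measure set T -> \bar R})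
    (I : choiceType) (r : seq I) (F : I -> set T) :
  uniq r -> (forall i, i \in r -> measurable (F i)) ->
  (forall i j t, i \in r -> j \in r -> F i t -> F j t -> i = j) ->
  m (\bigcup_(i in [set` r]) F i) = (\sum_(i <- r) m (F i))%E.
Proof.
move=> ur mF tF; rewrite measure_fin_bigcup //.
- by rewrite -fsbig_seq.
- by move=> i j ri rj [t [Fi Fj]]; exact: tF Fi Fj.
Qed.

Lemma cylinder_split P s : path edge [::] s ->
  P (cylinder s) = (\sum_(z <- up (last [::] s)) P (cylinder (rcons s z)))%E.
Proof.
move=> ps; rewrite -measure_bigcup_seq ?up_uniq //.
- congr (P _); apply/seteqP; split=> [u us|u [z /= _ /cylinder_rcons[]//]].
  exists (u (size s).+1); last by apply/cylinder_rcons.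
  by rewrite /= -(cylinder_vertex us); exact: vertexS.
- by move=> z zs; apply: measurable_cylinder; rewrite rcons_path ps.
- by move=> z1 z2 u _ _ /cylinder_rcons[_ <-] /cylinder_rcons[_ <-].
Qed.

Lemma central_distributed P : central P -> exists phi,
  [/\ distributed_by phi P, harmonic_fun phi, (forall x, 0 <= phi x) & phi [::] = 1].
Proof.
move=> cP.
pose phi v := fine (P (cylinder (s2val (cid2 (ex_path_to v))))).
have phiE : distributed_by phi P.
  move=> s ps; rewrite /phi; case: cid2 => t /= pt ts.
  rewrite fineK ?fin_num_measure //; last exact: measurable_cylinder.
  exact: cP.
exists phi; split => //.
- move=> x; have [s ps sx] := ex_path_to x.
  apply: EFin_inj; rewrite -sx -phiE // cylinder_split // -sumEFin.
  by apply: eq_big_seq => z zs; rewrite phiE ?last_rcons // rcons_path ps.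
- by move=> x; rewrite fine_ge0.
- apply: EFin_inj; rewrite -(phiE [::]) // cylinder_nil.
  exact: probability_setT.
Qed.

Lemma distributed_by_unique P1 P2 phi : distributed_by phi P1 ->
  distributed_by phi P2 -> forall A, measurable A -> P1 A = P2 A.
Proof.
move=> D1 D2 A mA.
(* Two cylinders are nested or disjoint, so adding the empty set makes the family stable under
   intersection. *)
pose G := cylinders `|` [set set0] : set (set path_space).
have mG : G `<=` measurable.
  by move=> X [|-> //]; apply: sub_sigma_algebra.
have GT X : G X -> X `<=` setT by [].
apply: (g_sigma_algebra_measure_unique_trace G setT) => //.
- by move=> X [] /mG.
- move=> X Y [GX _] [GY _]; split => //.
  have [X0|X0] := eqVneq X set0; first by rewrite X0 set0I; right.
  have [Y0|Y0] := eqVneq Y set0; first by rewrite Y0 setI0; right.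
  case: GX X0 => [[s ps <-] _|-> /eqP//]; case: GY Y0 => [[t pt <-] _|-> /eqP//].
  wlog st : s ps t pt / (size s <= size t)%N.
    move=> wl; case/orP: (leq_total (size s) (size t)); first exact: wl.
    by rewrite setIC; apply: wl.
  have [e|ne] := pselect (s = take (size s) t).
    left; exists t => //; apply/seteqP; split=> [u ut|u []//]; split => // i si.
    by rewrite ut ?(leq_trans si) // e nth_take.
  right; apply/seteqP; split=> // u [us ut]; apply: ne.
  apply: (@eq_from_nth _ [::]) => [|i si]; first by rewrite size_takel.
  by rewrite nth_take // -us // ut // (leq_trans si).
- exact: etrans (probability_setT P1) (esym (probability_setT P2)).
- move=> X [[[s ps <-]|->] _]; last by rewrite !measure0.
  exact: etrans (D1 s ps) (esym (D2 s ps)).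
- by have := probability_setT P1 => /= ->; rewrite ltry.
- suff -> : [set X | G X /\ X `<=` setT] = G.
    by apply: (sub_sigma_algebra2 (M := cylinders)) mA => X cX; left.
  by apply/seteqP; split=> [X []|X GX].
Qed.

Lemma distributed_by_central P phi : distributed_by phi P -> central P.
Proof. by move=> DP s t ps pt st; rewrite !DP // st. Qed.

(** The event is the disjoint union of the d(eps, v) cylinders of the finite paths ending at v, all
    of measure phi(v). *)
Lemma distributed_by_through P phi v : distributed_by phi P ->
  P (through v) = ((dpaths [::] v)%:R * phi v)%:E.
Proof.
move=> DP; pose r := [seq s <- up_paths (rank v) [::] | last [::] s == v].
have rP s : s \in r -> [/\ path edge [::] s, size s = rank v & last [::] s = v].
  by rewrite mem_filter mem_up_paths => /andP[/eqP ? /andP[/eqP ? ?]].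
have vertex_rank (u : yfpath) n : rank (u n) = n.
  by elim: n => [|n IHn]; rewrite ?vertex0 ?rank_nil // (rank_up (vertexS u n)) IHn.
have -> : through v = \bigcup_(s in [set` r]) (cylinder s : set path_space).
  apply/seteqP; split=> [u [n un]|u [s /= /rP[ps sv <-]] us]; last first.
    by exists (size s); exact: cylinder_vertex.
  have {}nv : n = rank v by rewrite -un vertex_rank.
  exists [seq u i.+1 | i <- iota 0 n]; last first.
    by move=> i; rewrite size_map size_iota => ni; rewrite (nth_map 0%N) ?size_iota // nth_iota.
  rewrite /= mem_filter mem_up_paths size_map size_iota nv eqxx /= -nv; apply/andP; split.
    rewrite -un; case: (n) => [|m]; first by rewrite vertex0.
    by rewrite -[in iota _ _]addn1 iotaD map_cat last_cat /= add0n.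
  rewrite -(vertex0 u) -[in u 0%N]/(0%N); move: (0%N) => k; elim: n k {un nv} => //= n IHn k.
  by rewrite IHn andbT; exact: vertexS.
rewrite measure_bigcup_seq.
- rewrite (eq_big_seq (fun=> (phi v)%:E)); last first.
    move=> s /rP[ps _ sv].
    by have := DP s ps; rewrite sv.
  rewrite sumEFin big_const_seq count_predT iter_addr_0 size_filter.
  by rewrite /dpaths rank_nil /= subn0 mulr_natl.
- by rewrite filter_uniq ?up_paths_uniq.
- by move=> s /rP[ps _ _]; exact: measurable_cylinder.
- move=> s t u /rP[_ ss _] /rP[_ ts _] us ut.
  apply: (@eq_from_nth _ [::]) => [|i si]; first by rewrite ss ts.
  by rewrite -us // ut // ts -ss.
Qed.
End path_measures.

(** * Construction of a central measure from a harmonic function *)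

Section existence.
Variables (R : realType) (phi : word -> R).
Hypothesis phi_ge0 : forall x, 0 <= phi x.
Hypothesis phi_harmonic : harmonic_fun phi.
Hypothesis phi_nil : phi [::] = 1.

(* Cuts the half-line into consecutive intervals of lengths phi z, z in l (the
   last one unbounded), and returns the z of the interval of r together with
   the offset of r in it. *)
Fixpoint child (l : seq word) (r : R) : word * R :=
  match l with
  | [::] => ([::], r)
  | z :: l' => if nilp l' || (r < phi z) then (z, r) else child l' (r - phi z)
  end.

Lemma child_mem l r : l != [::] -> (child l r).1 \in l.
Proof.
elim: l r => //= z l IHl r _; case: ifP => [_|/norP[l0 _]]; first by rewrite mem_head.
by rewrite in_cons IHl ?orbT // -size_eq0.
Qed.

Lemma child_itv l z : uniq l -> z \in l -> exists c,
  [/\ 0 <= c, c + phi z <= \sum_(y <- l) phi y &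
   forall r, 0 <= r < \sum_(y <- l) phi y ->
     ((child l r).1 == z) = (c <= r < c + phi z) /\
     (c <= r < c + phi z -> (child l r).2 = r - c)].
Proof.
elim: l => //= y l IHl /andP[yl ul]; rewrite in_cons.
have S0 : 0 <= \sum_(y <- l) phi y by apply: sumr_ge0.
have [-> _|zy /= zl] := eqVneq z y.
  exists 0; rewrite big_cons add0r lerDl; split => // r /andP[r0 rS].
  rewrite r0 subr0; case: ifP => [/orP[/nilP l0|ry]|].
  - by rewrite eqxx; move: rS; rewrite l0 big_nil addr0 => ->.
  - by rewrite eqxx ry.
  - case/norP => l0; rewrite -leNgt => ry; split; last by rewrite ltNge ry.
    rewrite ltNge ry; apply: contraNF yl => /eqP <-.
    by rewrite child_mem // -size_eq0.
have [c [c0 cS cP]] := IHl ul zl.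
exists (phi y + c); rewrite big_cons; split; first by rewrite addr_ge0.
  by rewrite -addrA lerD2l.
move=> r /andP[r0 rS].
have ln : nilp l = false by case: (l) zl.
rewrite ln /=; case: ltP => ry.
  rewrite eq_sym (negPf zy); suff -> : (phi y + c <= r) = false by [].
  by apply/negbTE; rewrite -ltNge (lt_le_trans ry) // lerDl.
have [|e1 e2] := cP (r - phi y); first by rewrite subr_ge0 ry ltrBlDl.
rewrite e1 lerBrDl ltrBlDl addrA; split => // rc.
by rewrite e2 ?opprD ?addrA // lerBrDl ltrBlDl addrA.
Qed.

Definition step (st : word * R) : word * R := child (up st.1) st.2.

Lemma up_neq_nil x : up x != [::].
Proof.
rewrite -size_eq0 /up size_cat size_map; apply/eqP => e.
have : size x \in [seq i <- iota 0 (size x).+1 | all (pred1 Two) (drop i x)].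
  by rewrite mem_filter drop_size mem_iota /= ltnS.
by case: [seq i <- _ | _] e.
Qed.

Lemma step_edge st : edge st.1 (step st).1.
Proof. exact/child_mem/up_neq_nil. Qed.

(** By harmonicity the interval [0, phi x) is cut into intervals of lengths phi z, z covering x.
    Iterated from [0, 1), this makes every cylinder correspond to an interval of length phi at its
    last vertex, so that Lebesgue measure on [0, 1) is carried to the desired law. *)
Definition path_of (r : R) : yfpath :=
  @YFPath (fun n => (iter n step ([::], r)).1) erefl
    (fun n => step_edge (iter n step ([::], r))).

Definition follows (st : word * R) (s : seq word) : Prop :=
  forall i, (i < size s)%N -> (iter i.+1 step st).1 = nth [::] s i.

Lemma follows_cons st z s :
  follows st (z :: s) <-> (step st).1 = z /\ follows (step st) s.
Proof.
split=> [sP|[sz sP] [|i] //= si]; last by rewrite -iterS iterSr sP.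
by split=> [|i si]; [exact: (sP 0%N)|rewrite -iterSr (sP i.+1)].
Qed.

Lemma measurable_child l z (B : set R) : measurable B ->
  measurable [set r | (child l r).1 = z /\ B (child l r).2].
Proof.
move=> mB; have mc (Q : Prop) : measurable [set r : R | Q /\ B r].
  have [q|q] := pselect Q.
    by rewrite (_ : [set r | _] = B) //; apply/seteqP; split => r //= [].
  by rewrite (_ : [set r | _] = set0) //; apply/seteqP; split => r //= [].
elim: l => /= [|y l IHl]; first exact: mc.
have [l0|l0] /= := boolP (nilp l); first exact: mc.
rewrite (_ : [set r | _] =
  ([set r | r < phi y] `&` [set r | y = z /\ B r]) `|`
  ([set r | phi y <= r] `&`
   (fun r => r - phi y) @^-1` [set r | (child l r).1 = z /\ B (child l r).2])).
  apply: measurableU; apply: measurableI => //.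
  - by rewrite -set_itvNyo; exact: measurable_itv.
  - by rewrite -set_itvcy; exact: measurable_itv.
  - have mf : measurable_fun setT (fun r : R => r - phi y).
      exact: measurable_realfun.measurable_funB.
    by rewrite -[X in measurable X]setTI; exact: mf.
apply/seteqP; split=> r /=.
  by case: ltP => ry rP; [left|right].
by case=> -[]; case: ltP.
Qed.

Lemma measurable_follows x s : measurable [set r | follows (x, r) s].
Proof.
elim: s x => [|z s IHs] x; first by rewrite (_ : [set _ | _] = setT) //; apply/seteqP; split.
rewrite (_ : [set r | _] =
    [set r | (child (up x) r).1 = z /\ [set r' | follows (z, r') s] (child (up x) r).2]).
  exact: measurable_child (IHs z).
apply/seteqP; split=> r /=; rewrite follows_cons /step /=;
  by case: (child (up x) r) => y r' /= [-> ?].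
Qed.

Lemma follows_itv x s : path edge x s -> exists a,
  [/\ 0 <= a, a + phi (last x s) <= phi x &
   forall r, 0 <= r < phi x ->
     follows (x, r) s <-> a <= r < a + phi (last x s)].
Proof.
elim: s x => [|z s IHs] x /=.
  by exists 0; split=> // [|r rx]; rewrite add0r.
case/andP => zx /IHs[a [a0 aS aP]].
have [c [c0 cS cP]] := child_itv (up_uniq x) zx.
rewrite phi_harmonic in cS cP.
exists (c + a); split=> [||r rx].
- by rewrite addr_ge0.
- by rewrite (le_trans _ cS) // -addrA lerD2l.
have [e1 e2] := cP r rx; rewrite follows_cons /step /=.
have -> : (c + a <= r < c + a + phi (last z s)) =
          (a <= r - c < a + phi (last z s)).
  by rewrite lerBrDl ltrBlDl addrA.
have aux : a <= r - c < a + phi (last z s) -> c <= r < c + phi z.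
  case/andP => ar ra; apply/andP; split; first by rewrite -subr_ge0 (le_trans a0).
  by rewrite -ltrBlDl (lt_le_trans ra).
split=> [[/eqP rz]|ar].
  have rc := rz; rewrite e1 in rc; move: rz => /eqP rz.
  have := e2 rc; case: (child (up x) r) rz => y r' /= -> -> /aP; apply.
  by rewrite subr_ge0 ltrBlDl.
have rc := aux ar; have := e2 rc; rewrite -e1 in rc.
case: (child (up x) r) rc => y r' /= /eqP -> ->; split=> //; apply/aP => //.
have /andP[? ?] := aux ar; by rewrite subr_ge0 ltrBlDl; apply/andP.
Qed.

Lemma measurable_path_of : measurable_fun setT (path_of : R -> path_space).
Proof.
apply: (@measurability _ _ _ path_space setT path_of cylinders) => //.
move=> _ [_ [s ps <-] <-]; rewrite setTI; exact: (measurable_follows [::] s).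
Qed.

Let m01 : {measure set (measurableTypeR R) -> \bar R} :=
  mrestr lebesgue_measure (measurable_itv `[0%R, 1%R[).

Let law0 := measure_function_pushforward__canonical__measure_function_Measure
  m01 measurable_path_of.

Let law : set path_space -> \bar R := law0.

Let law_set0 : law set0 = 0%E. Proof. exact: (measure0 law0). Qed.
Let law_ge0 A : (0 <= law A)%E. Proof. exact: (measure_ge0 law0). Qed.
Let law_sigma : semi_sigma_additive law.
Proof. exact: (@measure_semi_sigma_additive _ _ _ law0). Qed.

HB.instance Definition _ := isMeasure.Build _ _ _ law law_set0 law_ge0 law_sigma.

Let law_itv A a b : 0 <= a -> a <= b -> b <= 1 ->
  (forall r, 0 <= r < 1 -> A (path_of r) <-> a <= r < b) -> law A = (b - a)%:E.
Proof.
move=> a0 ab b1 AP; rewrite /law /= /pushforward /= /mrestr.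
have -> : path_of @^-1` A `&` `[0, 1[ = `[a, b[%classic :> set R.
  apply/seteqP; split=> r /=; rewrite !in_itv /=.
    by case=> /AP; apply.
  move=> rab; have r01 : 0 <= r < 1 by lra.
  by split=> //; apply/AP.
rewrite lebesgue_measure_itv /= lte_fin; case: ltgtP ab => // -> _.
by rewrite subrr.
Qed.

Let law_setT : law setT = 1%E.
Proof. by rewrite (@law_itv _ 0 1) ?subr0. Qed.

HB.instance Definition _ := Measure_isProbability.Build _ _ _ law law_setT.

Lemma exists_distributed_by : exists P : probability path_space R,
  distributed_by phi P.
Proof.
exists law => s ps; have [a [a0 a1 aP]] := follows_itv ps.
rewrite phi_nil in a1 aP.
have -> : phi (last [::] s) = a + phi (last [::] s) - a by ring.
by apply: law_itv => //; rewrite lerDl.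
Qed.
End existence.

(** * A criterion for ergodicity *)

Section ergodicity_criterion.
Variable R : realType.
Implicit Types (x v : word) (phi : word -> R) (P : probability path_space R).

Lemma harmonic_sum phi x n : harmonic_fun phi -> (rank x <= n)%N ->
  phi x = \sum_(v <- words n) (dpaths x v)%:R * phi v.
Proof.
move=> Hphi /subnKC <-; rewrite -sum_up_paths.
move: (n - rank x)%N => m; elim: m x => [|m IHm] x /=; first by rewrite big_seq1.
rewrite -Hphi big_flatten big_map; apply: eq_bigr => z _.
by rewrite big_map /= -IHm.
Qed.

Definition martin_kernel x v : R := (dpaths x v)%:R / twos_prod v 0.

(** The weight [twos_prod v 0 * phi v] is the probability that the path is at v at time n. *)
Definition deviation phi x n : R :=
  \sum_(v <- words n) twos_prod v 0 * phi v * `|martin_kernel x v - phi x|.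

(** One good level for each [x] and [e] is asked for; the Plancherel case exhibits odd levels. *)
Definition concentrated phi := forall x e, 0 < e ->
  exists2 n, (rank x <= n)%N & deviation phi x n <= e.

(** The mean of d(x, u_n) / d(eps, u_n) under psi is exactly psi(x), so psi(x) - phi(x) is the mean
    under psi of the kernel minus phi(x); domination bounds it by C times the deviation under
    phi. *)
Lemma concentrated_extreme phi psi (C : R) : concentrated phi -> 0 <= C ->
  harmonic_fun psi -> (forall x, 0 <= psi x) -> psi [::] = 1 ->
  (forall x, psi x <= C * phi x) -> psi =1 phi.
Proof.
move=> cphi C0 Hpsi psi0 psi1 psiC x; apply/eqP; rewrite -subr_eq0 -normr_le0.
apply/ler_addgt0Pl => e e0; rewrite addr0.
have [n xn dn] := cphi x (e / (1 + C)) (divr_gt0 e0 (ltr_wpDr C0 ltr01)).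
have qn v : twos_prod v 0 != 0 :> R by rewrite gt_eqF ?twos_prod_gt0.
have q0 v : 0 <= twos_prod v 0 :> R by rewrite ltW ?twos_prod_gt0.
have -> : psi x - phi x =
    \sum_(v <- words n) twos_prod v 0 * psi v * (martin_kernel x v - phi x).
  under eq_bigr do rewrite mulrBr.
  rewrite sumrB -mulr_suml (harmonic_sum Hpsi xn); congr (_ - _).
    by apply: eq_bigr => v _; rewrite /martin_kernel; field; apply: qn.
  rewrite -[LHS]mul1r -psi1 (@harmonic_sum psi [::] n) ?rank_nil //.
  by congr (_ * _); apply: eq_bigr => v _; rewrite dpaths_nil.
apply: le_trans (ler_norm_sum _ _ _) _.
apply: (@le_trans _ _ (C * deviation phi x n)).
  rewrite /deviation mulr_sumr; apply: ler_sum => v _.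
  rewrite !normrM (ger0_norm (psi0 v)) ger0_norm //.
  by rewrite mulrA ler_wpM2r // mulrCA ler_wpM2l.
apply: le_trans (ler_wpM2l C0 dn) _.
by rewrite mulrCA ler_piMr ?(ltW e0) // ler_pdivrMr ?mul1r ?lerDr ?ltr_wpDr.
Qed.

Lemma concentrated_ergodic phi P : distributed_by phi P -> concentrated phi ->
  ergodic P.
Proof.
move=> DP cphi; split; first exact: distributed_by_central DP.
move=> P1 P2 t /central_distributed[psi1 [D1 H1 p1 n1]].
move=> /central_distributed[psi2 [D2 H2 p2 n2]] /andP[t0 t1] Pt.
have phiE x : phi x = t * psi1 x + (1 - t) * psi2 x.
  have [s ps <-] := ex_path_to R x; apply: EFin_inj.
  by rewrite -DP // Pt ?D1 ?D2 //; exact: measurable_cylinder.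
have e1 : psi1 =1 phi.
  (* A component of weight t is dominated by 1 / t times the whole. *)
  apply: (@concentrated_extreme _ _ t^-1) => // [|x]; first by rewrite invr_ge0 ltW.
  by rewrite ler_pdivlMl // phiE lerDl mulr_ge0 // subr_ge0 ltW.
have e2 : psi2 =1 phi.
  apply: (@concentrated_extreme _ _ (1 - t)^-1) => // [|x].
    by rewrite invr_ge0 subr_ge0 ltW.
  by rewrite ler_pdivlMl ?subr_gt0 // phiE lerDr mulr_ge0 // ltW.
apply: (@distributed_by_unique _ _ _ phi) => s ps; first by rewrite D1 // e1.
by rewrite D2 // e2.
Qed.
End ergodicity_criterion.

(** * The Plancherel measure *)

Section plancherel.
Variable R : realType.
Implicit Types (x v : word) (w : infword).

Lemma psi_twos_prod x : psi R 0 x = twos_prod x 0 / ((rank x)`!)%:R.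
Proof.
elim/last_ind: x => [|x a IHx]; first by rewrite /= rank_nil divr1.
rewrite psi_rcons IHx twos_prod_rcons rank_rcons add0n.
have nS n : n.+1%:R = n%:R + 1 :> R by rewrite natr1.
have fz : 0 < ((rank x)`!)%:R :> R by rewrite ltr0n fact_gt0.
have r0 := ler0n R (rank x).
by case: a; rewrite ?addn1 ?addn2 !factS !natrM !nS; field; posnz.
Qed.

Lemma f_0 x w : f R x 0 (h x w) = psi R 0 x.
Proof.
rewrite -f0_psi; case: x => [|a x]; first by rewrite f_z0.
rewrite h_cons; case: ifP => _; last by rewrite f_z0.
by case: a; rewrite ?f_one_cons ?f_two_cons ?addr0.
Qed.

Lemma psi_gt0 x : 0 < psi R 0 x.
Proof. by rewrite psi_twos_prod divr_gt0 ?twos_prod_gt0 // ltr0n fact_gt0. Qed.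

Lemma psi_harmonic : harmonic_fun (psi R 0).
Proof. by move=> x; rewrite psi_up mul0r mul0r; case: ifP; rewrite subr0. Qed.

Definition twos_ratio v (t : R) : R := twos_prod v t / twos_prod v 0.

Lemma twos_ratio0 v : twos_ratio v 0 = 1.
Proof. by rewrite /twos_ratio divff // gt_eqF ?twos_prod_gt0. Qed.

Lemma twos_ratio_rcons v a t : twos_ratio (rcons v a) t =
  twos_ratio v t * (if a is Two then ((rank v).+1%:R - t) / (rank v).+1%:R else 1).
Proof.
rewrite /twos_ratio !twos_prod_rcons; case: a; rewrite ?mulr1 // subr0.
by rewrite invfM mulrACA.
Qed.

(* The product pi of a finite word; only a rightmost digit 2 has g = 1. *)
Definition pi_fin v : R :=
  if v is Two :: u then twos_prod u (-1) / twos_prod u (-2) else twos_ratio v 1.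

Lemma pi_fin_rcons v a : pi_fin (rcons v a) =
  pi_fin v * (if a is Two then
                if rank v == 0%N then 1 else (rank v)%:R / (rank v).+1%:R
              else 1).
Proof.
have nz n : n.+1%:R != 0 :> R by rewrite pnatr_eq0.
case: v => [|b v].
  by case: a; rewrite /= ?rank_nil /= /twos_ratio /= !(divr1, mulr1).
have -> : (rank (b :: v) == 0%N) = false by rewrite rank_eq0.
case: b; last first.
  rewrite /= !twos_prod_rcons rank_cons; case: a; rewrite ?mulr1 //.
  rewrite !opprK !add2n -!natr1 invfM mulrACA; congr (_ * (_ / _)).
  by ring.
rewrite /= -rcons_cons twos_ratio_rcons; case: a; rewrite ?mulr1 //.
by rewrite -natr1 addrK natr1.
Qed.

Lemma pi_fin_itv v : 0 <= pi_fin v <= 1.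
Proof.
elim/last_ind: v => [|v a /andP[v0 v1]]; first by rewrite /pi_fin /twos_ratio /= divr1 ler01 lexx.
rewrite pi_fin_rcons; case: a; first by rewrite mulr1 v0.
case: ifP => _; first by rewrite mulr1 v0.
rewrite mulr_ge0 //= mulr_ile1 // ler_pdivrMr ?ltr0n // mul1r ler_nat //.
Qed.

(** A digit 2 with g >= i contributes |g - i| / g, at most its factor in [pi_fin]. One with g < i
    exceeds that factor at most i times, and this happens only while the rank is below i. *)
Lemma twos_ratio_pi_fin v (i : nat) : (0 < i)%N ->
  `|twos_ratio v i%:R| <= pi_fin v * i%:R ^+ minn (rank v) i.
Proof.
move=> i0; have i1 : 1 <= i%:R :> R by rewrite ler1n.
have mono m n : (m <= n)%N -> i%:R ^+ m <= i%:R ^+ n :> R.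
  by move=> mn; rewrite ler_weXn2l.
elim/last_ind: v => [|v a IHv].
  by rewrite rank_nil min0n expr0 mulr1 /pi_fin /twos_ratio /= divr1 normr1.
have /andP[v0 v1] := pi_fin_itv v.
rewrite twos_ratio_rcons pi_fin_rcons rank_rcons; case: a; rewrite [dval _]/=.
  rewrite !mulr1 (le_trans IHv) // ler_wpM2l // mono //; lia.
have g0 : 0 < (rank v).+1%:R :> R by rewrite ltr0n.
rewrite normrM [X in _ * X]normf_div (ger0_norm (ltW g0)) -[leRHS]mulrA.
set c : R := (X in _ <= pi_fin v * (X * _)).
apply: (@le_trans _ _ (pi_fin v * i%:R ^+ minn (rank v) i *
    (`|(rank v).+1%:R - i%:R| / (rank v).+1%:R))).
  by rewrite ler_wpM2r // divr_ge0.
rewrite -mulrA ler_wpM2l //.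
have c0 : 0 < c by rewrite /c; case: ifP => // ?; rewrite divr_gt0 // ltr0n lt0n; apply/negbT.
have [ig|gi] := leqP i (rank v).+1.
  apply: (@le_trans _ _ (i%:R ^+ minn (rank v) i * c)).
    rewrite ler_wpM2l ?exprn_ge0 // ger0_norm ?subr_ge0 ?ler_nat // /c.
    case: ifP => _; first by rewrite ler_pdivrMr // mul1r gerBl.
    by rewrite ler_wpM2r ?invr_ge0 // -natr1; lra.
  by rewrite mulrC ler_wpM2l ?(ltW c0) // mono //; lia.
apply: (@le_trans _ _ (i%:R ^+ minn (rank v) i * (c * i%:R))).
  rewrite ler_wpM2l ?exprn_ge0 // ler_pdivrMr // ler0_norm ?subr_le0 ?ler_nat 1?ltnW // opprB.
  rewrite /c; case: ifP => [/eqP ->|rv]; first by rewrite mul1r mulr1; lra.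
  have r1 : 1 <= (rank v)%:R :> R by rewrite ler1n lt0n rv.
  rewrite mulrAC divfK ?gt_eqF //; move: r1; rewrite -natr1; nra.
by rewrite mulrCA ler_wpM2l ?(ltW c0) // -exprSr mono //; lia.
Qed.

Lemma h_le_size x w : (h x w <= size x)%N.
Proof. by elim: x w => //= a x IHx w; case: ifP => // _; rewrite ltnS IHx. Qed.

Definition f_bound x i : R := \sum_(z < (size x).+1) `|f R x i z|.

Lemma f_boundP x i w : `|f R x i (h x w)| <= f_bound x i.
Proof.
have hx : (h x w < (size x).+1)%N by rewrite ltnS h_le_size.
by rewrite /f_bound (bigD1 (Ordinal hx)) //= lerDl sumr_ge0.
Qed.

Lemma martin_kernelE x v : (rank x <= rank v)%N -> martin_kernel R x v =
  \sum_(i < (rank x).+1) f R x i (h x (pad v)) * twos_ratio v i%:R.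
Proof.
move=> xv; rewrite /martin_kernel dpaths_martin // /martin mulr_suml.
by apply: eq_bigr => i _; rewrite mulrA.
Qed.

(** n! times the mean of [pi_fin] under the Plancherel measure at level n. *)
Definition psum n : R := \sum_(v <- words n) twos_prod v 0 ^+ 2 * pi_fin v.

Lemma psum_rec n : psum n.+2 = psum n.+1 + (if n == 0%N then 1 else n.+1%:R * n%:R) * psum n.
Proof.
rewrite /psum wordsSS big_cat !big_map mulr_sumr; congr (_ + _).
  by apply: eq_bigr => v _; rewrite twos_prod_rcons pi_fin_rcons !mulr1.
apply: eq_big_seq => v; rewrite mem_words => /eqP vn.
rewrite twos_prod_rcons pi_fin_rcons vn subr0; case: eqP => [->|_].
  by rewrite !mulr1 mul1r.
have n0 := ler0n R n; rewrite -natr1; field; posnz.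
Qed.

(** The recursion of order two splits into two of order one, according to parity; over two levels
    [psum n / n!] is multiplied by (2k + 2) / (2k + 3). *)
Lemma psum_odd k : psum k.*2.+2 = k.*2.+2%:R * psum k.*2.+1 /\
                   psum k.*2.+3 = k.*2.+2%:R * psum k.*2.+2.
Proof.
have nS n : n.+1%:R = n%:R + 1 :> R by rewrite natr1.
elim: k => [|k [IH1 IH2]].
  have p0 : psum 0 = 1 by rewrite /psum big_seq1 /= /pi_fin /twos_ratio /= !divr1 expr1n mulr1.
  have p1 : psum 1 = 1 by rewrite /psum big_seq1 /= /pi_fin /twos_ratio /= !divr1 expr1n mulr1.
  by rewrite !psum_rec double0 /= p0 p1; split; ring.
rewrite doubleS; have e : psum k.*2.+4 = k.*2.+4%:R * psum k.*2.+3.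
  by rewrite psum_rec /= IH2 (nS k.*2.+3); ring.
split; first by [].
by rewrite psum_rec /= e (nS k.*2.+3); ring.
Qed.

(** The product of the factors (2k + 2) / (2k + 3) is of order k^(-1/2). Their squares are at most
    (k + 1) / (k + 2), whose product telescopes. *)
Lemma psum_bound k : (psum k.*2.+1 / (k.*2.+1`!)%:R) ^+ 2 <= k.+1%:R^-1.
Proof.
have nS n : n.+1%:R = n%:R + 1 :> R by rewrite natr1.
elim: k => [|k IHk].
  by rewrite /psum big_seq1 /= /pi_fin /twos_ratio /= !divr1 !(expr1n, mulr1) invr1.
have [IH1 IH2] := psum_odd k; rewrite doubleS IH2 IH1 (factS k.*2.+2).
rewrite (factS k.*2.+1) (natrM _ k.*2.+3) (natrM _ k.*2.+2).
set p := psum _ in IHk *; set F : R := (_`!)%:R in IHk *.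
have F0 : F != 0 by rewrite pnatr_eq0 -lt0n fact_gt0.
have k0 := ler0n R k.
have -> : (k.*2.+2%:R * (k.*2.+2%:R * p)) / (k.*2.+3%:R * (k.*2.+2%:R * F)) =
    (p / F) * (k.*2.+2%:R / k.*2.+3%:R).
  by rewrite !nS -muln2 natrM; field; rewrite F0 /=; posnz.
rewrite exprMn.
apply: (@le_trans _ _ (k.+1%:R^-1 * (k.*2.+2%:R / k.*2.+3%:R) ^+ 2)).
  by rewrite ler_wpM2r // sqr_ge0.
have q : (k.*2.+2%:R / k.*2.+3%:R) ^+ 2 <= k.+1%:R / k.+2%:R :> R.
  rewrite expr_div_n ler_pdivrMr ?exprn_gt0 ?ltr0n // mulrAC ler_pdivlMr ?ltr0n //.
  by rewrite !nS -muln2 natrM; nra.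
apply: le_trans (ler_wpM2l _ q) _; first by rewrite invr_ge0 ler0n.
by rewrite mulrA mulVf ?mul1r // pnatr_eq0.
Qed.

Lemma psi_concentrated : concentrated (psi R 0).
Proof.
move=> x e e0.
(* Only the terms i > 0 enter: the term i = 0 of the kernel is the Plancherel function itself. *)
pose M : R := \sum_(i < rank x) f_bound x i.+1 * i.+1%:R ^+ i.+1.
have M0 : 0 <= M.
  by apply: sumr_ge0 => i _; rewrite mulr_ge0 ?exprn_ge0 ?sumr_ge0.
have dev n : (rank x <= n)%N -> deviation (psi R 0) x n <= M * (psum n / (n`!)%:R).
  move=> xn; rewrite /deviation /psum mulrA mulr_sumr mulr_suml.
  rewrite big_seq [leRHS]big_seq; apply: ler_sum => v; rewrite mem_words => /eqP vn.
  rewrite psi_twos_prod vn mulrA -expr2 [leRHS]mulrAC mulrC.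
  rewrite [leRHS](_ : _ = (M * pi_fin v) * (twos_prod v 0 ^+ 2 / (n`!)%:R)); last by ring.
  rewrite ler_wpM2r ?divr_ge0 ?sqr_ge0 //.
  rewrite martin_kernelE ?vn // big_ord_recl twos_ratio0 mulr1.
  rewrite f_0.
  rewrite addrAC subrr add0r (le_trans (ler_norm_sum _ _ _)) // mulr_suml.
  apply: ler_sum => i _; rewrite normrM -mulrA ler_pM ?f_boundP //.
  rewrite (le_trans (twos_ratio_pi_fin _ _)) // mulrC ler_wpM2r //.
    by case/andP: (pi_fin_itv v).
  by rewrite ler_weXn2l ?ler1n // geq_minr.
have sq0 : 0 <= (M / e) ^+ 2 by rewrite sqr_ge0.
pose k := maxn (rank x) (Num.bound ((M / e) ^+ 2)).
have kM : (M / e) ^+ 2 <= k.+1%:R.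
  rewrite (le_trans (ltW (archi_boundP sq0))) // ler_nat.
  by rewrite (leq_trans (leq_maxr (rank x) _)).
have xk : (rank x <= k.*2.+1)%N.
  by rewrite (leq_trans (leq_maxl _ (Num.bound ((M / e) ^+ 2)))) // -/k -addnn; lia.
exists k.*2.+1 => //; rewrite (le_trans (dev _ xk)) //.
have y0 : 0 <= psum k.*2.+1 / (k.*2.+1`!)%:R.
  rewrite divr_ge0 // sumr_ge0 // => v _; rewrite mulr_ge0 ?sqr_ge0 //.
  by case/andP: (pi_fin_itv v).
move: (psum _ / _) (psum_bound k) y0 => y yk y0.
rewrite -(@ler_pXn2r _ 2) ?nnegrE ?mulr_ge0 ?(ltW e0) // exprMn.
apply: le_trans (ler_wpM2l (sqr_ge0 M) yk) _.
by rewrite ler_pdivrMr ?ltr0n // mulrC -ler_pdivrMr ?exprn_gt0 // -expr_div_n.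
Qed.

Lemma exists_plancherel : exists P : probability path_space R, is_plancherel P.
Proof.
have [P DP] := exists_distributed_by (fun x => ltW (psi_gt0 x)) psi_harmonic erefl.
exists P; split; first exact: distributed_by_central DP.
move=> v; rewrite (distributed_by_through v DP) psi_twos_prod dpaths_nil.
by rewrite mulrA expr2.
Qed.

Lemma plancherel_ergodic (P : probability path_space R) :
  is_plancherel P -> ergodic P.
Proof.
case=> /central_distributed[phi [DP _ _ _]] PT.
apply: (concentrated_ergodic _ psi_concentrated) => s /DP ->; congr (_%:E).
have q0 : twos_prod (last [::] s) 0 != 0 :> R by rewrite gt_eqF ?twos_prod_gt0.
have := PT (last [::] s); rewrite (distributed_by_through _ DP) => -[].
rewrite dpaths_nil expr2 -[RHS]mulrA => /(mulfI q0) ->.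
by rewrite psi_twos_prod.
Qed.
End plancherel.

(** * Level averages over the paths to a vertex *)

Section suffix_averages.
Variable R : realType.
Implicit Types (x v s : word) (t : R).

Lemma sum_down_cons (F : word -> R) a x :
  \sum_(u <- down (a :: x)) F u = \sum_(u <- down x) F (a :: u) +
  (if all_two x then F (if a is One then x else One :: x) else 0).
Proof.
rewrite /= big_cat big_map; congr (_ + _).
by case: ifP; rewrite ?big_seq1 ?big_nil.
Qed.

(** For t = i this is d(eps, v) p_i(v) restricted to the words with suffix [s], a list prefix since
    words are stored from the right. *)
Definition twos_prod_suffix s t v : R := if prefix s v then twos_prod v t else 0.

(** If it vanished everywhere, the sums of d(u, V) times the function over the u of a level would
    not depend on the level. *)
Definition defect s t v : R := \sum_(u <- down v) twos_prod_suffix s t u - twos_prod_suffix s t v.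

Lemma defect_nil t x : defect [::] t x = - (if all_two x then twos_prod x (t + 1) else 0).
Proof.
rewrite /defect /twos_prod_suffix /=; elim: x t => [|a x IHx] t.
  by rewrite big_nil /= sub0r.
rewrite sum_down_cons all_two_cons; case: a => /=.
  have -> : \sum_(u <- down x) twos_prod u (t - 1) =
      twos_prod x (t - 1) - (if all_two x then twos_prod x t else 0).
    have := IHx (t - 1); under eq_bigr do rewrite prefix0s.
    by rewrite subrK prefix0s => /(canRL (subrK _)) ->; rewrite addrC.
  by rewrite oppr0 prefix0s; case: (all_two x); ring.
rewrite -mulr_sumr.
have -> : \sum_(u <- down x) twos_prod u (t - 2) =
    twos_prod x (t - 2) - (if all_two x then twos_prod x (t - 1) else 0).
  have := IHx (t - 2); have -> : t - 2 + 1 = t - 1 by ring.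
  under eq_bigr do rewrite prefix0s.
  by rewrite prefix0s => /(canRL (subrK _)) ->; rewrite addrC.
have -> : t + 1 - 2 = t - 1 by ring.
by case: (all_two x); ring.
Qed.

Lemma prefix_One_two s x : all_two x -> prefix (One :: s) x = false.
Proof. by case: x => [|[]]. Qed.

Lemma defect_cons_nil a s t : defect (a :: s) t [::] = 0.
Proof. by rewrite /defect big_nil /twos_prod_suffix /= subr0. Qed.

Lemma defect_one s t x : defect (One :: s) t (One :: x) = defect s (t - 1) x.
Proof.
rewrite /defect sum_down_cons /twos_prod_suffix [in X in _ - X]prefix_cons eqxx /=.
have -> : (if all_two x then if prefix (One :: s) x then twos_prod x t else 0 else 0) = 0.
  by case: ifP => // /prefix_One_two ->.
by rewrite addr0.
Qed.

Lemma defect_two s t x : defect (Two :: s) t (Two :: x) = (1 - t) * defect s (t - 2) x.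
Proof.
rewrite /defect sum_down_cons /twos_prod_suffix mulrBr mulr_sumr /= if_same addr0.
congr (_ - _); first apply: eq_bigr => u _; by case: ifP => // _; rewrite mulr0.
Qed.

Lemma defect_one_two s t x : defect (One :: s) t (Two :: x) =
  if all_two x && prefix s x then twos_prod x (t - 1) else 0.
Proof.
rewrite /defect sum_down_cons /twos_prod_suffix /= big1 // add0r subr0.
by case: (all_two x).
Qed.

Lemma defect_two_one s t x : defect (Two :: s) t (One :: x) =
  if all_two x && prefix (Two :: s) x then twos_prod x t else 0.
Proof.
rewrite /defect sum_down_cons /twos_prod_suffix [X in X - _ = _]/= big1 // add0r subr0.
by case: (all_two x).
Qed.

Lemma twos_prod_antimono v t1 t2 : t1 <= t2 -> t2 <= 0 -> twos_prod v t2 <= twos_prod v t1.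
Proof.
elim: v t1 t2 => [|[] v IHv] t1 t2 t12 t20 //=; first by apply: IHv; lra.
by rewrite ler_pM ?IHv //; try lra; rewrite ltW ?twos_prod_gt0 //; lra.
Qed.

(** Along the words 2...2, p_i decays like rank^(-i/2), hence at least like rank^(-2) when i >= 4.
    The shift [M] accounts for digits removed at the right. *)
Lemma twos_prod_all_two_bound (i M : nat) : (4 <= i)%N -> exists2 C : R, 0 <= C &
  forall x, all_two x ->
    `|twos_prod x (i%:R - M%:R)| * (rank x + M + 2)%:R ^+ 2 <= C * twos_prod x (- M%:R).
Proof.
move=> i4.
pose y a : R := `|twos_prod (nseq a Two) (i%:R - M%:R)| * (a.*2 + M + 2)%:R ^+ 2.
have y0 a : 0 <= y a by rewrite mulr_ge0 ?sqr_ge0.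
have rk a : rank (nseq a Two) = a.*2.
  by elim: a => [|a IHa]; rewrite ?rank_nil // rank_cons IHa doubleS.
(* The constant covers the words with at most i digits; beyond these the new factors are
   nonnegative. *)
exists (\sum_(a < i.+1) y a) => [|x /all_twoP ->]; first exact: sumr_ge0.
set C := \sum_(a < i.+1) y a; have C0 : 0 <= C by apply: sumr_ge0.
move: (size x) => {x} a; rewrite rk -/(y a).
have z1 b : 1 <= twos_prod (nseq b Two) (- M%:R) :> R by rewrite twos_prod_ge1 // oppr_le0.
have [ai|] := leqP a i.
  apply: (@le_trans _ _ C); last by rewrite ler_peMr.
  by rewrite /C (bigD1 (Ordinal (ai : (a < i.+1)%N))) //= lerDl sumr_ge0.
elim: a => // a IHa; rewrite ltnS leq_eqVlt => ia.
have {IHa} : y a <= C * twos_prod (nseq a Two) (- M%:R).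
  case/orP: ia => [/eqP <-|/IHa //].
  apply: (@le_trans _ _ C); last by rewrite ler_peMr.
  by rewrite /C (bigD1 ord_max) //= lerDl sumr_ge0.
have {}ia : (i <= a)%N by case/orP: ia => [/eqP ->|/ltnW].
have -> : nseq a.+1 Two = rcons (nseq a Two) Two.
  by elim: (a) => //= b ->.
rewrite /y; have -> : nseq a.+1 Two = rcons (nseq a Two) Two.
  by elim: (a) => //= b ->.
rewrite !twos_prod_rcons rk normrM => ya.
pose m : R := (a.*2 + M + 2)%:R.
have mE : m = a.*2%:R + M%:R + 2 by rewrite /m !natrD.
have ai : i%:R <= a%:R :> R by rewrite ler_nat.
have i4' : 4 <= i%:R :> R by rewrite ler_nat.
have M0 := ler0n R M.
have a2 : a.*2%:R = 2 * a%:R :> R by rewrite -mul2n natrM.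
have -> : (a.*2.+1)%:R - (i%:R - M%:R) = m - 1 - i%:R.
  by rewrite mE -natr1; ring.
have -> : (a.*2.+1)%:R - - M%:R = m - 1 by rewrite mE -natr1; ring.
have -> : (a.+1.*2 + M + 2)%:R = m + 2 by rewrite mE doubleS !natrD -!natr1; ring.
rewrite (ger0_norm (_ : 0 <= m - 1 - i%:R)); last by rewrite mE a2; lra.
apply: (@le_trans _ _ (`|twos_prod (nseq a Two) (i%:R - M%:R)| * m ^+ 2 * (m - 1))).
  rewrite -!mulrA ler_wpM2l //.
  have m5 : 5 <= m by rewrite mE a2; lra.
  (* i >= 4 gives m - 1 - i <= m - 5, and (m - 5) (m + 2)^2 = m^2 (m - 1) - 16 m - 20. *)
  apply: (@le_trans _ _ ((m - 5) * (m + 2) ^+ 2)).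
    by rewrite ler_wpM2r ?sqr_ge0 //; lra.
  nra.
rewrite mulrA ler_wpM2r //; by rewrite mE a2; lra.
Qed.

(** Removing a common rightmost digit lowers t by its value, so [M] grows while [i] stays fixed. At
    a mismatch, or when [s] is exhausted, the defect is carried by words 2...2. *)
Lemma defect_bound s (i M : nat) : (4 <= i)%N -> exists2 C : R, 0 <= C &
  forall v, `|defect s (i%:R - M%:R) v| * (rank v).+1%:R ^+ 2 <= C * twos_prod v (- M%:R).
Proof.
move=> i4; elim: s M => [|a s IHs] M.
  have i5 : (4 <= i.+1)%N by rewrite ltnW.
  have [C C0 CP] := twos_prod_all_two_bound M i5.
  exists C => // v; rewrite defect_nil normrN; case: ifP => av; last first.
    by rewrite normr0 mul0r mulr_ge0 // ltW ?twos_prod_gt0 // oppr_le0.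
  have -> : i%:R - M%:R + 1 = i.+1%:R - M%:R :> R by rewrite -natr1; ring.
  apply: le_trans (CP _ av); rewrite ler_wpM2l // ler_pXn2r ?nnegrE ?ler_nat //; lia.
have [C0 C0_ge0 C0P] := twos_prod_all_two_bound M i4.
have [C1 C1_ge0 C1P] := twos_prod_all_two_bound M.+1 i4.
have NM : - M%:R <= 0 :> R by rewrite oppr_le0.
have M0 := ler0n R M.
have q0 v t : t <= 0 -> 0 <= twos_prod v t :> R by move=> t0; rewrite ltW ?twos_prod_gt0.
have M1 : 0 <= 1 - - M%:R :> R by lra.
have e1 : i%:R - M%:R - 1 = i%:R - M.+1%:R :> R by rewrite -natr1; ring.
have e2 : i%:R - M%:R - 2 = i%:R - M.+2%:R :> R by rewrite -!natr1; ring.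
have f1 : - M.+1%:R = - M%:R - 1 :> R by rewrite -natr1; ring.
have f2 : - M.+2%:R = - M%:R - 2 :> R by rewrite -!natr1; ring.
have NM1 : - M.+1%:R <= 0 :> R by rewrite oppr_le0.
have NM2 : - M.+2%:R <= 0 :> R by rewrite oppr_le0.
case: a.
  have [C2 C2_ge0 C2P] := IHs M.+1.
  (* 4 = 2^2, as the rank plus one at most doubles when a digit 1 is restored. *)
  exists (4 * C2 + C1) => [|[|[] x]].
  - by rewrite addr_ge0 ?mulr_ge0.
  - by rewrite defect_cons_nil normr0 mul0r mulr_ge0 ?addr_ge0 ?mulr_ge0 // ltW ?twos_prod_gt0.
  - rewrite defect_one e1 rank_cons [twos_prod (One :: x) _]/= -f1 mulrDl ler_wpDr //.
      by rewrite mulr_ge0 // ltW ?twos_prod_gt0.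
    rewrite -mulrA; apply: le_trans (ler_wpM2l _ (C2P x)) => //.
    rewrite [leRHS]mulrCA ler_wpM2l // (_ : 4 = 2 ^+ 2) -?exprMn; last by ring.
    by rewrite ler_pXn2r ?nnegrE // -natrM ler_nat /=; lia.
  - rewrite defect_one_two e1; case: ifP => [/andP[ax _]|_]; last first.
    rewrite normr0 mul0r; apply: mulr_ge0; last exact: q0.
    by rewrite addr_ge0 ?mulr_ge0.
    rewrite [twos_prod (Two :: x) _]/= -f2 mulrDl ler_wpDl //.
      by rewrite !mulr_ge0 ?q0.
    apply: (@le_trans _ _ (C1 * twos_prod x (- M.+1%:R))).
      apply: le_trans (C1P _ ax); rewrite ler_wpM2l // rank_cons.
      by rewrite ler_pXn2r ?nnegrE // ler_nat /=; lia.
    rewrite ler_wpM2l //; apply: (@le_trans _ _ (twos_prod x (- M.+2%:R))).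
      by apply: twos_prod_antimono; lra.
    by rewrite ler_peMl ?(ltW (twos_prod_gt0 _ _)) //; lra.
have [C2 C2_ge0 C2P] := IHs M.+2.
pose D : R := `|1 - (i%:R - M%:R)|.
have D0 : 0 <= D by exact: normr_ge0.
(* 9 = 3^2 plays the same role for a digit 2, whose factor 1 - t is bounded by [D]. *)
exists (9 * D * C2 + C0) => [|[|[] x]].
- by rewrite addr_ge0 // !mulr_ge0.
- by rewrite defect_cons_nil normr0 mul0r mulr_ge0 ?q0 // addr_ge0 // !mulr_ge0.
- rewrite defect_two_one; case: ifP => [/andP[ax _]|_]; last first.
    rewrite normr0 mul0r; apply: mulr_ge0; last exact: q0.
    by rewrite addr_ge0 // !mulr_ge0.
  rewrite [twos_prod (One :: x) _]/= -f1 mulrDl ler_wpDl //.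
    by rewrite !mulr_ge0 ?q0.
  apply: (@le_trans _ _ (C0 * twos_prod x (- M%:R))).
    apply: le_trans (C0P _ ax); rewrite ler_wpM2l // rank_cons.
    by rewrite ler_pXn2r ?nnegrE // ler_nat /=; lia.
  by rewrite ler_wpM2l //; apply: twos_prod_antimono; lra.
- rewrite defect_two e2 normrM -/D rank_cons [twos_prod (Two :: x) _]/= -f2 mulrDl ler_wpDr //.
    by rewrite !mulr_ge0 ?q0.
  apply: (@le_trans _ _ (9 * D * (C2 * twos_prod x (- M.+2%:R)))); last first.
    rewrite -!mulrA ler_wpM2l // ler_wpM2l // ler_wpM2l //.
    by rewrite ler_peMl ?(ltW (twos_prod_gt0 _ _)) //; lra.
  rewrite -[9 * D]mulrC -!mulrA ler_wpM2l //.
  apply: le_trans (ler_wpM2l _ (C2P x)) => //.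
  rewrite [leRHS]mulrCA ler_wpM2l // (_ : 9 = 3 ^+ 2) -?exprMn; last by ring.
  by rewrite ler_pXn2r ?nnegrE // -natrM ler_nat /=; lia.
Qed.

Lemma sum_dpaths_down V n (Q : word -> R) : (n < rank V)%N ->
  \sum_(u <- words n) (dpaths u V)%:R * Q u =
  \sum_(v <- words n.+1) (dpaths v V)%:R * \sum_(u <- down v) Q u.
Proof.
move=> nV.
have -> : \sum_(u <- words n) (dpaths u V)%:R * Q u =
    \sum_(u <- words n) \sum_(v <- up u) (dpaths v V)%:R * Q u.
  apply: eq_big_seq => u; rewrite mem_words => /eqP un.
  by rewrite dpaths_lt ?un // natr_sum mulr_suml.
by rewrite words_up_down; apply: eq_bigr => v _; rewrite mulr_sumr.
Qed.

Lemma sum_dpaths_eq V (Q : word -> R) :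
  \sum_(u <- words (rank V)) (dpaths u V)%:R * Q u = Q V.
Proof.
rewrite (bigD1_seq V) ?mem_words ?words_uniq //= dpaths_eq // eqxx mul1r.
rewrite big_seq_cond big1 ?addr0 // => v; rewrite mem_words => /andP[/eqP vV].
by move=> /negPf vV'; rewrite dpaths_eq // vV' mul0r.
Qed.

Lemma sum_dpaths_twos_prod V n : (n <= rank V)%N ->
  \sum_(u <- words n) (dpaths u V)%:R * twos_prod u 0 = twos_prod V 0 :> R.
Proof.
move=> nV; have := leqnn (rank V - n)%N; move: {2}(rank V - n)%N => m.
elim: m n nV => [|m IHm] n nV nm.
  have -> : n = rank V by lia.
  by rewrite sum_dpaths_eq.
have [->|nV'] := eqVneq n (rank V); first by rewrite sum_dpaths_eq.
have {}nV : (n < rank V)%N by rewrite ltn_neqAle nV'.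
rewrite sum_dpaths_down // -[RHS](IHm n.+1) //; last by lia.
apply: eq_big_seq => v; rewrite mem_words => /eqP vn; congr (_ * _).
have := defect_nil 0 v; rewrite /defect /twos_prod_suffix prefix0s.
under eq_bigr do rewrite prefix0s.
move=> /(canRL (subrK _)) ->; case: ifP => av; last by rewrite oppr0 add0r.
case: v av vn => [|[] v] // _; first by rewrite rank_nil.
(* At t = 0 the defect is evaluated at t + 1 = 1, where the factor of a rightmost 2 is zero. *)
by rewrite [twos_prod (Two :: v) (0 + 1)]/= add0r subrr mul0r oppr0 add0r.
Qed.

(* The average of [twos_prod_suffix s i / d(eps, .)] over the vertices of level n of
   the paths to V hardly depends on n, as that function is invariant under
   [down] up to [defect_bound]. *)
Lemma kernel_average s (i : nat) : (4 <= i)%N -> exists2 C : R, 0 <= C &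
  forall V n, (n <= rank V)%N ->
    `|\sum_(v <- words n) martin_kernel R v V * twos_prod_suffix s i%:R v -
      twos_prod_suffix s i%:R V / twos_prod V 0| <= C / n.+1%:R.
Proof.
move=> i4; have [C C0 CP] := @defect_bound s i 0 i4.
exists C => // V n nV.
have qV : 0 < twos_prod V 0 :> R by rewrite twos_prod_gt0.
have -> : \sum_(v <- words n) martin_kernel R v V * twos_prod_suffix s i%:R v =
    (\sum_(v <- words n) (dpaths v V)%:R * twos_prod_suffix s i%:R v) / twos_prod V 0.
  by rewrite mulr_suml; apply: eq_bigr => v _; rewrite mulrAC.
rewrite -mulrBl normrM normfV (ger0_norm (ltW qV)) ler_pdivrMr //.
(* Sharpened to be zero at the level of V: the step from n to n + 1 costs C / (n + 2)^2, less than C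
   times 1 / (n + 1) - 1 / (n + 2). *)
apply: (@le_trans _ _ (C * (n.+1%:R^-1 - (rank V).+1%:R^-1) * twos_prod V 0)); last first.
  by rewrite ler_wpM2r ?(ltW qV) // ler_wpM2l // gerBl invr_ge0.
have := leqnn (rank V - n)%N; move: {2}(rank V - n)%N => m.
elim: m n nV => [|m IHm] n nV nm.
  have -> : n = rank V by lia.
  by rewrite sum_dpaths_eq !subrr normr0 mulr0 mul0r.
have [->|nV'] := eqVneq n (rank V).
  by rewrite sum_dpaths_eq !subrr normr0 mulr0 mul0r.
have {}nV : (n < rank V)%N by rewrite ltn_neqAle nV'.
have IH := IHm _ nV ltac:(lia).
rewrite sum_dpaths_down //.
have -> : \sum_(v <- words n.+1) (dpaths v V)%:R * (\sum_(u <- down v) twos_prod_suffix s i%:R u) =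
    \sum_(v <- words n.+1) (dpaths v V)%:R * twos_prod_suffix s i%:R v +
    \sum_(v <- words n.+1) (dpaths v V)%:R * defect s i%:R v.
  by rewrite -big_split; apply: eq_bigr => v _; rewrite /= -mulrDr /defect addrC subrK.
rewrite addrAC (le_trans (ler_normD _ _)) //.
apply: (@le_trans _ _ (C * (n.+2%:R^-1 - (rank V).+1%:R^-1) * twos_prod V 0 +
    C * (n.+2%:R ^- 2) * twos_prod V 0)).
  rewrite lerD // (le_trans (ler_norm_sum _ _ _)) //.
  rewrite -(sum_dpaths_twos_prod nV) mulr_sumr big_seq [leRHS]big_seq; apply: ler_sum => v.
  rewrite mem_words => /eqP vn; rewrite normrM normr_nat mulrCA ler_wpM2l //.
  rewrite mulrAC ler_pdivlMr ?exprn_gt0 // -vn.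
  by have := CP v; rewrite subr0 oppr0.
rewrite -mulrDl ler_wpM2r ?(ltW qV) // -mulrDr ler_wpM2l //.
rewrite addrAC lerD2r -(natr1 n.+1).
have n1 : 1 <= n.+1%:R :> R by rewrite ler1n.
move: (n.+1%:R : R) n1 => y y1.
rewrite -subr_ge0 (_ : _ - _ = 1 / (y * (y + 1) ^+ 2)); last by field; posnz.
by rewrite divr_ge0 ?mulr_ge0 ?sqr_ge0 //; lra.
Qed.
End suffix_averages.

(** * Infinite words *)

Section infinite_words.
Variable R : realType.
Implicit Types (x v u : word) (w : infword).

Definition wtake w m : word := mkseq w m.

Lemma wtakeS w m : wtake w m.+1 = rcons (wtake w m) (w m).
Proof. exact: mkseqS. Qed.

Lemma g_wtake w k : g w k = (rank (wtake w k)).+1.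
Proof.
elim: k => [|k IHk]; first by rewrite g0 rank_nil.
by rewrite wtakeS rank_rcons -addSn -IHk /g big_ord_recr addnA.
Qed.

Lemma size_wtake w m : size (wtake w m) = m.
Proof. exact: size_mkseq. Qed.

Lemma size_le_rank x : (size x <= rank x)%N.
Proof. by rewrite rank_twos leq_addr. Qed.

Lemma leq_rank_wtake w m : (m <= rank (wtake w m))%N.
Proof. by rewrite -{1}(size_wtake w m) size_le_rank. Qed.

Lemma prod_g_wtake w t m :
  \prod_(k < m | w k == Two) (((g w k)%:R - t) / (g w k)%:R : R) = twos_ratio (wtake w m) t.
Proof.
elim: m => [|m IHm]; first by rewrite big_ord0 /twos_ratio /= divr1.
rewrite big_mkcond big_ord_recr -big_mkcond IHm wtakeS twos_ratio_rcons -g_wtake /=.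
by case: (w m).
Qed.

Lemma pi_word_wtake w m :
  \prod_(k < m | (w k == Two) && (1 < g w k)%N)
     (((g w k)%:R - 1) / (g w k)%:R : R) = pi_fin R (wtake w m).
Proof.
elim: m => [|m IHm]; first by rewrite big_ord0 /pi_fin /twos_ratio /= divr1.
rewrite big_mkcond big_ord_recr -big_mkcond IHm wtakeS pi_fin_rcons g_wtake /=.
case: (w m) => //=; rewrite ltnS; case: eqP => [->|/eqP r0] //=.
by rewrite lt0n r0 -natr1 addrK natr1.
Qed.

Lemma mkseq_cat w m n : wtake w (m + n) = wtake w m ++ wtake (fun k => w (m + k)%N) n.
Proof.
rewrite /wtake /mkseq iotaD map_cat; congr (_ ++ _).
by rewrite add0n -[m in iota m]addn0 iotaDl -map_comp.
Qed.

(* The part of [twos_ratio] due to the digits 2 of [u] when [u] is put to the left of a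
   word of rank [N]. *)
Definition twos_ratio_tail (N : nat) u (t : R) : R := twos_prod u (t - N%:R) / twos_prod u (- N%:R).

Lemma twos_ratio_cat v u t : twos_ratio (v ++ u) t = twos_ratio v t * twos_ratio_tail (rank v) u t.
Proof. by rewrite /twos_ratio /twos_ratio_tail !twos_prod_cat sub0r invfM mulrACA. Qed.

Lemma twos_ratio_tail_rcons N u a t : twos_ratio_tail N (rcons u a) t = twos_ratio_tail N u t *
  (if a is Two then ((N + rank u).+1%:R - t) / (N + rank u).+1%:R else 1).
Proof.
rewrite /twos_ratio_tail !twos_prod_rcons; case: a; rewrite ?mulr1 //.
rewrite invfM mulrACA; congr (_ * (_ / _)); rewrite -addnS natrD; ring.
Qed.

Lemma twos_ratio_tail_nil N t : twos_ratio_tail N [::] t = 1.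
Proof. by rewrite /twos_ratio_tail divr1. Qed.

Lemma pi_fin_cat v u : (0 < rank v)%N ->
  pi_fin R (v ++ u) = pi_fin R v * twos_ratio_tail (rank v) u 1.
Proof.
move=> v0; elim/last_ind: u => [|u a IHu].
  by rewrite cats0 twos_ratio_tail_nil mulr1.
rewrite -rcons_cat pi_fin_rcons IHu twos_ratio_tail_rcons -mulrA rank_cat; congr (_ * (_ * _)).
case: a => //; rewrite addn_eq0 eqn0Ngt v0 /= -natr1 addrK //.
Qed.

Lemma bernoulli_bounds (z : R) (i : nat) : 0 <= z <= 1 ->
  1 - i%:R * z <= (1 - z) ^+ i <= 1 - i%:R * z + i%:R ^+ 2 * z ^+ 2.
Proof.
move=> /andP[z0 z1]; elim: i => [|i /andP[IH1 IH2]].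
  by rewrite expr0 mul0r expr0n mul0r subr0 addr0 lexx.
have i0 := ler0n R i; rewrite exprS -natr1.
have z10 : 0 <= 1 - z by lra.
have z2 : 0 <= z ^+ 2 by rewrite sqr_ge0.
apply/andP; split.
  by apply: le_trans (ler_wpM2l z10 IH1); nra.
apply: le_trans (ler_wpM2l z10 IH2) _.
have iz : 0 <= i%:R * z ^+ 2 by rewrite mulr_ge0.
have iz3 : 0 <= i%:R ^+ 2 * z ^+ 3 by rewrite mulr_ge0 ?exprn_ge0.
rewrite -subr_ge0.
have -> : 1 - (i%:R + 1) * z + (i%:R + 1) ^+ 2 * z ^+ 2 -
    (1 - z) * (1 - i%:R * z + i%:R ^+ 2 * z ^+ 2) =
    i%:R * z ^+ 2 + z ^+ 2 + i%:R ^+ 2 * z ^+ 3 by ring.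
by rewrite !addr_ge0.
Qed.

(** With z = 1 / g, the factors 1 - i z and (1 - z)^i differ by at most i^2 z^2. A digit 2 placed at
    rank m has g = m + 1 and raises the rank to m + 2, and 1 / (m + 1)^2 <= 1 / m - 1 / (m + 2), so
    the errors telescope; i <= N keeps all factors nonnegative. *)
Lemma twos_ratio_tail_power N u (i : nat) : (0 < N)%N -> (i <= N)%N ->
  [/\ 0 <= twos_ratio_tail N u i%:R, twos_ratio_tail N u i%:R <= twos_ratio_tail N u 1 ^+ i,
      twos_ratio_tail N u 1 <= 1, 0 <= twos_ratio_tail N u 1 &
   twos_ratio_tail N u 1 ^+ i - twos_ratio_tail N u i%:R <=
     i%:R ^+ 2 * (N%:R^-1 - (N + rank u)%:R^-1)].
Proof.
move=> N0 iN; elim/last_ind: u => [|u a [T0 TT T1 S0 IHu]].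
  by rewrite !twos_ratio_tail_nil rank_nil addn0 expr1n !subrr mulr0.
rewrite !twos_ratio_tail_rcons; case: a.
  rewrite !mulr1; split => //; apply: le_trans IHu _.
  rewrite ler_wpM2l ?sqr_ge0 // lerD2l lerN2 lef_pV2 ?posrE ?ltr0n ?addn_gt0 ?N0 //.
  by rewrite ler_nat leq_add2l rank_rcons leq_addr.
set m := (N + rank u)%N; pose z : R := m.+1%:R^-1.
have m0 : (0 < m)%N by rewrite addn_gt0 N0.
have nz : m.+1%:R != 0 :> R by rewrite pnatr_eq0.
have zP : 0 <= z <= 1 by rewrite invr_ge0 ler0n /= invf_le1 ?ltr0n // ler1n.
have -> : (m.+1%:R - i%:R) / m.+1%:R = 1 - i%:R * z by rewrite mulrBl divff.
have -> : (m.+1%:R - 1) / m.+1%:R = 1 - z by rewrite mulrBl divff // mul1r.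
have /andP[B1 B2] := bernoulli_bounds i zP; have /andP[z0 z1] := zP.
have iz : i%:R * z <= 1.
  by rewrite ler_pdivrMr ?ltr0n // mul1r ler_nat ltnW // ltnS (leq_trans iN) ?leq_addr.
have b0 : 0 <= 1 - i%:R * z by lra.
have a1 : (1 - z) ^+ i <= 1 by rewrite exprn_ile1 //; lra.
rewrite exprMn; split.
- exact: mulr_ge0.
- exact: ler_pM.
- by rewrite mulr_ile1 //; lra.
- by rewrite mulr_ge0 //; lra.
have T1' : twos_ratio_tail N u i%:R <= 1 by rewrite (le_trans TT) // exprn_ile1.
have -> : twos_ratio_tail N u 1 ^+ i * (1 - z) ^+ i - twos_ratio_tail N u i%:R * (1 - i%:R * z) =
  (twos_ratio_tail N u 1 ^+ i - twos_ratio_tail N u i%:R) * (1 - z) ^+ i +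
  twos_ratio_tail N u i%:R * ((1 - z) ^+ i - (1 - i%:R * z)) by ring.
apply: (@le_trans _ _ ((twos_ratio_tail N u 1 ^+ i - twos_ratio_tail N u i%:R) +
    i%:R ^+ 2 * z ^+ 2)).
  rewrite lerD //; first by rewrite ler_piMr // subr_ge0.
  apply: (@le_trans _ _ ((1 - z) ^+ i - (1 - i%:R * z))); last by lra.
  by rewrite ler_piMl // subr_ge0.
apply: le_trans (lerD IHu (lexx _)) _.
rewrite -mulrDr ler_wpM2l ?sqr_ge0 // -[leLHS]addrA lerD2l -/m.
rewrite rank_rcons [dval _]/= addn2 !addnS -/m.
rewrite /z; have : 1 <= m%:R :> R by rewrite ler1n.
rewrite -!natr1; move: (m%:R : R) => y y1.
rewrite -subr_ge0 (_ : _ - _ = (y ^+ 2 + 2 * y + 2) / (y * (y + 1) ^+ 2 * (y + 1 + 1))).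
  by rewrite divr_ge0 // ?addr_ge0 ?mulr_ge0 ?sqr_ge0 //; lra.
by field; posnz.
Qed.
End infinite_words.

(** * Limits along the suffixes of an infinite word *)

Section limits.
Variable R : realType.
Implicit Types (x v u : word) (w : infword).

Lemma cvg_sum_seq (I : eqType) (r : seq I) (u : I -> nat -> R) (l : I -> R) :
  (forall i, i \in r -> u i n @[n --> \oo] --> l i) ->
  \sum_(i <- r) u i n @[n --> \oo] --> \sum_(i <- r) l i.
Proof.
elim: r => [|i r IHr] ul.
  by rewrite big_nil; under eq_fun do rewrite big_nil; exact: cvg_cst.
rewrite big_cons; under eq_fun do rewrite big_cons.
apply: cvgD; first by apply: ul; rewrite mem_head.
by apply: IHr => j jr; apply: ul; rewrite in_cons jr orbT.
Qed.

Lemma twos_ratio_tail_decr N u a (i : nat) : (0 < N)%N -> (i <= N)%N ->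
  twos_ratio_tail N (rcons u a) i%:R <= twos_ratio_tail N u i%:R :> R.
Proof.
move=> N0 iN; have [T0 _ _ _ _] := twos_ratio_tail_power R u N0 iN.
rewrite twos_ratio_tail_rcons; case: a; rewrite ?mulr1 // ler_piMr //.
by rewrite ler_pdivrMr ?ltr0n // mul1r gerBl.
Qed.

Lemma cvg_twos_ratio w (i : nat) :
  (twos_ratio (wtake w m) i%:R : R) @[m --> \oo] --> prod_g R w i.
Proof.
have -> : prod_g R w i = limn (fun m => twos_ratio (wtake w m) i%:R : R).
  by rewrite /prod_g; under eq_fun do rewrite prod_g_wtake.
apply/cvg_ex.
(* Beyond i + 1 digits every g exceeds i, so the remaining products are nonnegative and
   nonincreasing. *)
pose N := rank (wtake w i.+1); pose w' k := w (i.+1 + k)%N.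
have iN : (i < N)%N := leq_rank_wtake w i.+1.
have N0 : (0 < N)%N by rewrite (leq_ltn_trans _ iN).
pose T m : R := twos_ratio_tail N (wtake w' m) i%:R.
have /cvg_ex[l Tl] : cvgn T.
  apply: nonincreasing_is_cvgn.
    apply/nonincreasing_seqP => m; rewrite /T wtakeS.
    by apply: twos_ratio_tail_decr => //; exact: ltnW.
  exists 0 => _ [m _ <-].
  by have [] := twos_ratio_tail_power R (wtake w' m) N0 (ltnW iN).
exists (twos_ratio (wtake w i.+1) i%:R * l); rewrite -(cvg_shiftn i.+1) /=.
under eq_fun do rewrite addnC mkseq_cat twos_ratio_cat.
exact: cvgMl_tmp.
Qed.

Lemma pi_fin_rcons_le v a : pi_fin R (rcons v a) <= pi_fin R v.
Proof.
have /andP[v0 _] := pi_fin_itv R v.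
rewrite pi_fin_rcons; case: a; rewrite ?mulr1 //.
case: ifP => _; rewrite ?mulr1 // ler_piMr // ler_pdivrMr ?ltr0n // mul1r ler_nat //.
Qed.

Lemma cvg_pi_fin w : pi_fin R (wtake w m) @[m --> \oo] --> pi_word R w.
Proof.
have -> : pi_word R w = limn (fun m => pi_fin R (wtake w m)).
  by rewrite /pi_word; under eq_fun do rewrite pi_word_wtake.
apply/cvg_ex; apply/cvg_ex/nonincreasing_is_cvgn.
  by apply/nonincreasing_seqP => m; rewrite wtakeS pi_fin_rcons_le.
by exists 0 => _ [m _ <-]; have /andP[] := pi_fin_itv R (wtake w m).
Qed.

Lemma pi_word_le w m : pi_word R w <= pi_fin R (wtake w m).
Proof.
have -> : pi_word R w = limn (fun m => pi_fin R (wtake w m)).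
  by rewrite /pi_word; under eq_fun do rewrite pi_word_wtake.
apply: nonincreasing_cvgn_ge; last by apply/cvg_ex; exists (pi_word R w); exact: cvg_pi_fin.
by apply/nonincreasing_seqP => k; rewrite wtakeS pi_fin_rcons_le.
Qed.

Lemma twos_ratio_wtake_neq0 w (i m : nat) : avoids w i -> twos_ratio (wtake w m) i%:R != 0 :> R.
Proof.
move=> wi; elim: m => [|m IHm]; first by rewrite /twos_ratio /= divr1 oner_neq0.
rewrite wtakeS twos_ratio_rcons mulf_neq0 // -g_wtake; case E : (w m); first exact: oner_neq0.
rewrite mulf_neq0 ?invr_neq0 ?pnatr_eq0 // subr_eq0 eqr_nat; exact: wi.
Qed.

Lemma cvg_rank_inv w : (rank (wtake w m))%:R^-1 @[m --> \oo] --> (0 : R).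
Proof.
have iv : (fun m => m%:R^-1 : R) @ \oo --> (0 : R).
  by rewrite -(cvg_shiftn 1) /=; under eq_fun do rewrite addn1; exact: cvg_harmonic.
apply: (squeeze_cvgr _ (cvg_cst (0 : R)) iv).
exists 1%N => // m /= m1; rewrite invr_ge0 ler0n /=.
have := leq_rank_wtake w m => mr.
by rewrite lef_pV2 ?posrE ?ltr0n ?ler_nat // (leq_trans m1).
Qed.

Lemma prod_g_neq0 w (i : nat) : 0 < pi_word R w -> avoids w i ->
  prod_g R w i != 0.
Proof.
move=> w0 wi; pose p := pi_word R w.
(* A lower bound for p_i of any stretch of w to the left of w_k: pi(w) > 0 bounds p_1 of the stretch
   from below, and [twos_ratio_tail_power] passes to p_i. Once it exceeds 1/2, the product cannot
   tend to 0, its initial part being nonzero by avoidance. *)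
pose rho k : R := (p / pi_fin R (wtake w k)) ^+ i -
  i%:R ^+ 2 * (rank (wtake w k))%:R^-1.
have rho1 : rho k @[k --> \oo] --> (1 : R).
  have -> : (1 : R) = (p / p) ^+ i - i%:R ^+ 2 * 0.
    by rewrite divff ?gt_eqF // expr1n mulr0 subr0.
  apply: cvgB; last by apply: cvgMl_tmp; exact: cvg_rank_inv.
  apply: (cvg_comp (fun k => p / pi_fin R (wtake w k)) (fun z : R => z ^+ i)).
    by apply: cvgMl_tmp; apply: cvgV; [rewrite gt_eqF|exact: cvg_pi_fin].
  exact: exprn_continuous.
have half : (2^-1 : R) < 1 by lra.
have [K _ KP] := cvgr_ge _ rho1 _ half.
pose k := maxn K i.+1; have kK : (K <= k)%N by rewrite leq_maxl.
have ki : (i < k)%N by rewrite leq_maxr.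
have iN : (i <= rank (wtake w k))%N by rewrite (leq_trans (ltnW ki)) ?leq_rank_wtake.
have N0 : (0 < rank (wtake w k))%N.
  by rewrite (leq_trans _ (leq_rank_wtake w k)) // (leq_ltn_trans _ ki).
have pk : twos_ratio (wtake w k) i%:R != 0 :> R by exact: twos_ratio_wtake_neq0.
have pi0 m : 0 < pi_fin R (wtake w m) by exact: lt_le_trans (pi_word_le w m).
suff : `|twos_ratio (wtake w k) i%:R| / 2 <= `|prod_g R w i|.
  by apply: contraTneq => ->; rewrite normr0 -ltNge divr_gt0 ?normr_gt0.
have cN : `|twos_ratio (wtake w m) i%:R : R| @[m --> \oo] --> `|prod_g R w i|.
  by apply: cvg_norm; exact: cvg_twos_ratio.
apply: (cvgr_to_ge cN).
exists k => // m /= km; rewrite -(subnKC km) mkseq_cat twos_ratio_cat [leRHS]normrM ler_wpM2l //.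
set u := wtake _ (m - k); have [T0 _ _ S0 TT] := twos_ratio_tail_power R u N0 iN.
rewrite ger0_norm //; apply: le_trans (KP _ kK) _; rewrite /rho.
have pT : p / pi_fin R (wtake w k) <= twos_ratio_tail (rank (wtake w k)) u 1.
  rewrite ler_pdivrMr // [leRHS]mulrC -pi_fin_cat // -mkseq_cat.
  exact: pi_word_le.
apply: (@le_trans _ _ (twos_ratio_tail (rank (wtake w k)) u 1 ^+ i -
    i%:R ^+ 2 / (rank (wtake w k))%:R)).
  rewrite lerD2r; apply: lerXn2r => //; rewrite nnegrE.
  by apply: divr_ge0; exact: ltW.
rewrite lerBlDr -lerBlDl (le_trans TT) // ler_wpM2l ?sqr_ge0 // gerBl invr_ge0 //.
Qed.

(* The values of g at two digits 2 differ by at least 2. *)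
Lemma avoids_succ w (i : nat) : avoids w i \/ avoids w i.+1.
Proof.
have [wi|nwi] := pselect (avoids w i); [by left|right].
have [k [wk gk]] : exists k, w k = Two /\ g w k = i.
  apply: contrapT => no; apply: nwi => k wk; apply/eqP => gk.
  by apply: no; exists k.
have mono a c : (a <= c)%N -> (rank (wtake w a) <= rank (wtake w c))%N.
  by move=> /subnKC <-; rewrite mkseq_cat rank_cat leq_addr.
move=> l wl; rewrite -gk !g_wtake eqSS; case: (ltngtP k l) => [kl|lk|->].
- by have := mono _ _ kl; rewrite wtakeS rank_rcons wk /=; lia.
- by have := mono _ _ lk; rewrite wtakeS rank_rcons wl /=; lia.
- by lia.
Qed.
End limits.

(** * The measures mu_(w, b) *)

Section boundary_kernels.
Variables (R : realType) (w : infword) (b : R).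
Implicit Types (x v u : word).

Lemma eq_h x w1 w2 : (forall j, (j < size x)%N -> w1 j = w2 j) -> h x w1 = h x w2.
Proof.
elim: x w1 w2 => //= a x IHx w1 w2 w12; rewrite w12 //; case: ifP => // _.
by congr _.+1; apply: IHx => j jx; apply: w12.
Qed.

Lemma pad_wtake k u j : (j < k)%N -> pad (wtake w k ++ u) j = w j.
Proof. by move=> jk; rewrite /pad nth_cat size_wtake jk nth_mkseq. Qed.

Lemma cvg_boundary (V : nat -> word) x :
  (forall k, exists u, V k = wtake w k.+1 ++ u) ->
  (forall i : nat, twos_ratio (V k) i%:R @[k --> \oo] --> b ^+ i * prod_g R w i) ->
  martin_kernel R x (V k) @[k --> \oo] --> d' b x w.
Proof.
(* From this index on, V k shares enough digits with w to have the same h, and its rank is at least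
   |x|. *)
move=> Vw Vp; rewrite -(cvg_shiftn (size x + rank x)) /=.
have -> : (fun k => martin_kernel R x (V (k + (size x + rank x))%N)) =
    (fun k => \sum_(i < (rank x).+1)
       f R x i (h x w) * twos_ratio (V (k + (size x + rank x))%N) i%:R).
  apply/funext => k; have [u Vu] := Vw (k + (size x + rank x))%N.
  rewrite martin_kernelE; last first.
    rewrite Vu rank_cat (leq_trans _ (leq_addr _ _)) //.
    by rewrite (leq_trans _ (leq_rank_wtake w _)) //; lia.
  rewrite (@eq_h _ _ w) // => j jx; rewrite Vu pad_wtake //; lia.
have -> : d' b x w = \sum_(i < (rank x).+1) f R x i (h x w) * (b ^+ i * prod_g R w i).
  by apply: eq_bigr => i _; ring.
apply: cvg_sum_seq => i _; apply: cvgMl_tmp.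
by have := Vp i; rewrite -(cvg_shiftn (size x + rank x)).
Qed.

Lemma power_lipschitz (y z : R) (i : nat) : 0 <= y <= 1 -> 0 <= z <= 1 ->
  `|y ^+ i - z ^+ i| <= i%:R * `|y - z|.
Proof.
move=> /andP[y0 y1] /andP[z0 z1]; elim: i => [|i IHi].
  by rewrite !expr0 subrr normr0 mul0r.
have -> : y ^+ i.+1 - z ^+ i.+1 = y * (y ^+ i - z ^+ i) + (y - z) * z ^+ i.
  by rewrite !exprS; ring.
rewrite (le_trans (ler_normD _ _)) // !normrM -natr1 mulrDl mul1r lerD //.
  by apply: le_trans IHi; rewrite ger0_norm // ler_piMl.
by rewrite ler_piMr // normrX ger0_norm // exprn_ile1.
Qed.

Hypothesis b_itv : 0 < b <= 1.

(** Adding digits 2 one by one lowers the ratio from 1 towards 0 in steps of size at most 1 / N; the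
    first value below b is within 1 / N of it. *)
Lemma exists_tail_near (N : nat) : (0 < N)%N -> exists u,
  `|twos_ratio_tail N u 1 - b| <= N%:R^-1.
Proof.
move=> N0; have /andP[b0 b1] := b_itv.
pose T c : R := twos_ratio_tail N (nseq c Two) 1.
have rk c : rank (nseq c Two) = c.*2.
  by elim: c => [|c IHc]; rewrite ?rank_nil // rank_cons IHc doubleS.
have TS c : T c.+1 = T c * ((N + c.*2)%:R / (N + c.*2).+1%:R).
  rewrite /T; have -> : nseq c.+1 Two = rcons (nseq c Two) Two.
    by elim: (c) => //= d ->.
  by rewrite twos_ratio_tail_rcons rk -natr1 addrK.
have T0 : T 0%N = 1 by rewrite /T twos_ratio_tail_nil.
have T01 c : 0 <= T c <= 1.
  by have [_ _ h1 h2 _] := twos_ratio_tail_power R (nseq c Two) N0 N0; rewrite /T h1 h2.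
have Tsq c : T c ^+ 2 <= N%:R / (N + c.*2)%:R.
  elim: c => [|c IHc].
    by rewrite T0 addn0 divff ?expr1n // pnatr_eq0 -lt0n.
  rewrite TS exprMn; apply: le_trans (ler_wpM2r (sqr_ge0 _) IHc) _.
  have : 1 <= (N + c.*2)%:R :> R by rewrite ler1n addn_gt0 N0.
  rewrite doubleS !addnS -!natr1; have := ler0n R N.
  move: (N%:R : R) ((N + c.*2)%:R : R) => n y n0 y1.
  rewrite -subr_ge0 (_ : _ - _ = n / ((y + 1) ^+ 2 * (y + 1 + 1))); last by field; posnz.
  by rewrite divr_ge0 // mulr_ge0 ?sqr_ge0 //; lra.
have [c Tc] : exists c, T c < b.
  pose c := Num.bound (N%:R / b ^+ 2); exists c.
  have cb : N%:R / b ^+ 2 < c%:R by apply: archi_boundP; rewrite divr_ge0 ?sqr_ge0.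
  have /andP[Tc0 _] := T01 c.
  rewrite -(@ltr_pXn2r _ 2) ?nnegrE ?(ltW b0) //; apply: le_lt_trans (Tsq c) _.
  rewrite ltr_pdivrMr ?ltr0n ?addn_gt0 ?N0 // mulrC -ltr_pdivrMr ?exprn_gt0 //.
  by apply: lt_le_trans cb _; rewrite ler_nat -addnn; lia.
have [m Tm mmin] := ex_minnP (ex_intro (fun c => T c < b) c Tc).
case: m Tm mmin => [|m] Tm mmin; first by move: Tm; rewrite T0 ltNge b1.
exists (nseq m Two); rewrite -/(T m).
have bT : b <= T m by rewrite leNgt; apply/negP => /mmin; rewrite ltnn.
rewrite ger0_norm ?subr_ge0 //; have /andP[Tm0 Tm1] := T01 m.
have y0 : 0 < N%:R :> R by rewrite ltr0n.
have yN : N%:R <= (N + m.*2)%:R :> R by rewrite ler_nat leq_addr.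
have : T m - T m.+1 <= N%:R^-1; last by lra.
rewrite TS -natr1; move: ((N + m.*2)%:R : R) yN => y yN.
have -> : T m - T m * (y / (y + 1)) = T m / (y + 1) by field; posnz.
rewrite ler_pdivrMr; last by lra.
apply: (le_trans Tm1); rewrite ler_pdivlMl // mulr1; lra.
Qed.

Lemma exists_boundary_sequence : exists V : nat -> word,
  (forall k, exists u, V k = wtake w k.+1 ++ u) /\
  (forall i : nat, twos_ratio (V k) i%:R @[k --> \oo] --> b ^+ i * prod_g R w i).
Proof.
have /andP[b0 b1] := b_itv.
have N0 k : (0 < rank (wtake w k.+1))%N by rewrite (leq_trans _ (leq_rank_wtake w _)).
have /choice[U UP] := fun k => exists_tail_near (N0 k).
exists (fun k => wtake w k.+1 ++ U k); split=> [k|i]; first by exists (U k).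
pose p k : R := twos_ratio (wtake w k.+1) i%:R; pose N k := rank (wtake w k.+1).
pose S k : R := twos_ratio_tail (N k) (U k) i%:R.
have iv : (N k)%:R^-1 @[k --> \oo] --> (0 : R).
  have := @cvg_rank_inv R w; rewrite -(cvg_shiftn 1) /=.
  by under eq_fun do rewrite addn1.
have pl : p k @[k --> \oo] --> prod_g R w i.
  by have := @cvg_twos_ratio R w i; rewrite -(cvg_shiftn 1) /=; under eq_fun do rewrite addn1.
have Sl : S k @[k --> \oo] --> b ^+ i.
  have iv2 : (i%:R ^+ 2 + i%:R) * (N k)%:R^-1 @[k --> \oo] --> (0 : R).
    by rewrite -[0](mulr0 (i%:R ^+ 2 + i%:R)); apply: cvgMl_tmp.
  apply/subr_cvg0.
  have iv2N : - ((i%:R ^+ 2 + i%:R) * (N k)%:R^-1) @[k --> \oo] --> (0 : R).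
    by rewrite -[0]oppr0; exact: cvgN.
  apply: (squeeze_cvgr _ iv2N iv2); exists i => // k /= ik; rewrite -ler_norml.
  have iN : (i <= N k)%N by rewrite (leq_trans _ (leq_rank_wtake w _)) // ltnW.
  have [S0 ST T1 T0 TS] := twos_ratio_tail_power R (U k) (N0 k) iN.
  have Xb : `|twos_ratio_tail (N k) (U k) 1 ^+ i - b ^+ i| <= i%:R * (N k)%:R^-1.
    apply: le_trans (power_lipschitz i _ _) _; first by rewrite T0.
      by rewrite (ltW b0).
    by rewrite ler_wpM2l // UP.
  have -> : S k - b ^+ i = (S k - twos_ratio_tail (N k) (U k) 1 ^+ i) +
      (twos_ratio_tail (N k) (U k) 1 ^+ i - b ^+ i) by ring.
  rewrite (le_trans (ler_normD _ _)) // mulrDl lerD // distrC ger0_norm ?subr_ge0 //.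
  by apply: le_trans TS _; rewrite ler_wpM2l ?sqr_ge0 // gerBl invr_ge0.
have -> : (fun k => twos_ratio (wtake w k.+1 ++ U k) i%:R) = p \* S.
  by apply/funext => k; rewrite twos_ratio_cat.
by rewrite mulrC; exact: cvgM.
Qed.

End boundary_kernels.

(** (t^l - 1) / l is nondecreasing in l, and its increment from i to i + 1 is already at least the
    quadratic bound. *)
Lemma power_gap (R : realType) (t : R) (i j : nat) : 0 <= t -> (0 < i < j)%N ->
  (t - 1) ^+ 2 / (i%:R * i.+1%:R) <=
  t ^+ j / j%:R - t ^+ i / i%:R + i%:R^-1 - j%:R^-1.
Proof.
move=> t0 /andP[i0 ij].
have nS n : n.+1%:R = n%:R + 1 :> R by rewrite natr1.
have gap l : (0 < l)%N -> (t - 1) ^+ 2 <= l%:R * t ^+ l.+1 - l.+1%:R * t ^+ l + 1.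
  elim: l => // -[_ _|l IHl _]; first by rewrite -subr_ge0 (_ : _ - _ = 0) //; ring.
  apply: le_trans (IHl isT) _; rewrite -subr_ge0.
  rewrite (_ : _ - _ = l.+2%:R * t ^+ l.+1 * (t - 1) ^+ 2).
    apply: mulr_ge0; last exact: sqr_ge0.
    by apply: mulr_ge0 => //; exact: exprn_ge0.
  by rewrite !nS !exprS; ring.
pose G l : R := t ^+ l / l%:R - l%:R^-1.
have GS l : (0 < l)%N -> G l.+1 - G l =
    (l%:R * t ^+ l.+1 - l.+1%:R * t ^+ l + 1) / (l%:R * l.+1%:R).
  move=> l0; have : 1 <= l%:R :> R by rewrite ler1n.
  by rewrite /G nS => l1; field; posnz.
have Gmono a c : (0 < a <= c)%N -> G a <= G c.
  case/andP => a0 /subnKC <-; elim: (c - a)%N => [|m IHm]; first by rewrite addn0.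
  apply: le_trans IHm _; rewrite addnS -subr_ge0 GS ?addn_gt0 ?a0 //.
  by rewrite divr_ge0 // (le_trans (sqr_ge0 _) (gap _ _)) // addn_gt0 a0.
apply: (@le_trans _ _ (G i.+1 - G i)).
  by rewrite GS // ler_wpM2r ?gap // invr_ge0 mulr_ge0.
have -> : t ^+ j / j%:R - t ^+ i / i%:R + i%:R^-1 - j%:R^-1 = G j - G i.
  by rewrite /G; ring.
by rewrite lerD2r; apply: Gmono.
Qed.

(** * Concentration of the measures mu_(w, b) *)

Section boundary_measures.
Variables (R : realType) (w : infword) (b : R).
Implicit Types (x v u : word).

Let phi x : R := d' b x w.

Variable V : nat -> word.
Hypothesis Vw : forall k, exists u, V k = wtake w k.+1 ++ u.
Hypothesis Vp : forall i : nat, twos_ratio (V k) i%:R @[k --> \oo] --> b ^+ i * prod_g R w i.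

Let leq_rank_V k : (k <= rank (V k))%N.
Proof.
have [u ->] := Vw k.
by rewrite rank_cat (leq_trans _ (leq_addr _ _)) // (leq_trans _ (leq_rank_wtake w _)).
Qed.

Let kernel_phi x : martin_kernel R x (V k) @[k --> \oo] --> phi x.
Proof. exact: cvg_boundary. Qed.

Lemma martin_kernel_itv x v : (rank x <= rank v)%N -> 0 <= martin_kernel R x v <= 1.
Proof.
move=> xv; have qv : 0 < twos_prod v 0 :> R by rewrite twos_prod_gt0.
rewrite divr_ge0 ?(ltW qv) //= ler_pdivrMr // mul1r -(sum_dpaths_twos_prod R xv).
rewrite (bigD1_seq x) ?mem_words ?words_uniq //= ler_wpDr //.
  by apply: sumr_ge0 => u _; rewrite mulr_ge0 // ltW ?twos_prod_gt0.
by rewrite ler_peMr // twos_prod_ge1.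
Qed.

(** The sum defining d'_b has signs; positivity is inherited from the kernels of which it is the
    limit. *)
Lemma boundary_itv x : 0 <= phi x <= 1.
Proof.
apply/andP; split.
  apply: (cvgr_to_ge (@kernel_phi x)); exists (rank x) => // k /= xk.
  by have /andP[] := martin_kernel_itv (leq_trans xk (leq_rank_V k)).
apply: (cvgr_to_le (@kernel_phi x)); exists (rank x) => // k /= xk.
by have /andP[] := martin_kernel_itv (leq_trans xk (leq_rank_V k)).
Qed.

Lemma boundary_harmonic : harmonic_fun phi.
Proof.
move=> x; apply: (cvg_unique (@Rhausdorff R) _ (@kernel_phi x)).
have : \sum_(z <- up x) martin_kernel R z (V k) @[k --> \oo] --> \sum_(z <- up x) phi z.
  by apply: cvg_sum_seq => z _; exact: kernel_phi.
apply: cvg_trans; apply: near_eq_cvg; exists (rank x).+1 => // k /= xk.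
rewrite /martin_kernel dpaths_lt ?(leq_trans xk) // natr_sum mulr_suml //.
Qed.

Lemma boundary_nil : phi [::] = 1.
Proof.
apply: (cvg_unique (@Rhausdorff R) (@kernel_phi [::])).
have -> : (fun k => martin_kernel R [::] (V k)) = cst 1; last exact: cvg_cst.
by apply/funext => k; rewrite /martin_kernel dpaths_nil divff // gt_eqF ?twos_prod_gt0.
Qed.

(** The limit of [kernel_average] along the words V m, which have suffix w_k once m >= k; its
    constant does not depend on m. *)
Lemma suffix_average (i k : nat) : (4 <= i)%N -> exists2 C : R, 0 <= C & forall n,
  `|\sum_(v <- words n) phi v * twos_prod_suffix (wtake w k) i%:R v - b ^+ i * prod_g R w i|
    <= C / n.+1%:R.
Proof.
move=> i4; have [C C0 CP] := kernel_average R (wtake w k) i4.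
exists C => // n.
pose D m : R := \sum_(v <- words n) twos_prod_suffix (wtake w k) i%:R v * martin_kernel R v (V m) -
  twos_ratio (V m) i%:R.
have cD : `|D m| @[m --> \oo] -->
    `|\sum_(v <- words n) twos_prod_suffix (wtake w k) i%:R v * phi v - b ^+ i * prod_g R w i|.
  apply: cvg_norm; apply: cvgB => //; apply: cvg_sum_seq => v _; apply: cvgMl_tmp.
  exact: kernel_phi.
under eq_bigr do rewrite mulrC.
apply: (cvgr_to_le cD); exists (k + n)%N => // m /= knm.
have nV : (n <= rank (V m))%N by rewrite (leq_trans _ (leq_rank_V m)) //; lia.
have := CP (V m) n nV; rewrite /D; under eq_bigr do rewrite mulrC.
suff -> : twos_prod_suffix (wtake w k) (i%:R : R) (V m) = twos_prod (V m) i%:R by [].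
rewrite /twos_prod_suffix; have [u ->] := Vw m.
have -> : wtake w m.+1 = wtake w k ++ wtake (fun j => w (k + j)%N) (m.+1 - k).
  by rewrite -mkseq_cat subnKC //; lia.
by rewrite -catA prefix_prefix.
Qed.

Definition avg n (F : word -> R) : R := \sum_(v <- words n) twos_prod v 0 * phi v * F v.

Lemma avg1 n : avg n (fun=> 1) = 1.
Proof.
rewrite -{2}boundary_nil (harmonic_sum (n := n) boundary_harmonic) ?rank_nil //.
by apply: eq_bigr => v _; rewrite mulr1 dpaths_nil.
Qed.

Lemma le_avg n F G : (forall v, rank v = n -> F v <= G v) -> avg n F <= avg n G.
Proof.
move=> FG; rewrite /avg big_seq [leRHS]big_seq; apply: ler_sum => v.
rewrite mem_words => /eqP vn; rewrite ler_wpM2l ?FG // mulr_ge0 ?(ltW (twos_prod_gt0 _ _)) //.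
by have /andP[] := boundary_itv v.
Qed.

Lemma eq_avg n F G : (forall v, rank v = n -> F v = G v) -> avg n F = avg n G.
Proof. by move=> FG; apply/le_anti; rewrite !le_avg // => v /FG ->. Qed.

Lemma avgD n F G : avg n (fun v => F v + G v) = avg n F + avg n G.
Proof. by rewrite -big_split; apply: eq_bigr => v _; rewrite mulrDr. Qed.

Lemma avgZ n c F : avg n (fun v => c * F v) = c * avg n F.
Proof. by rewrite /avg mulr_sumr; apply: eq_bigr => v _; rewrite mulrCA. Qed.

Lemma avg_ge0 n F : (forall v, rank v = n -> 0 <= F v) -> 0 <= avg n F.
Proof.
move=> F0; rewrite -(mul0r (avg n (fun=> 1))) -avgZ; apply: le_avg => v /F0.
by rewrite mul0r.
Qed.

Definition ends_as k v : R := (prefix (wtake w k) v)%:R.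

(** The variable T: the share of p_1(v) due to the digits left of w_k. It has this meaning only if v
    has suffix w_k, hence the factor [ends_as] in the means. *)
Definition left_ratio k v : R := twos_ratio_tail (rank (wtake w k)) (drop k v) 1.

Lemma ends_as_split k v : prefix (wtake w k) v -> v = wtake w k ++ drop k v.
Proof.
case/prefixP => u ->; congr (_ ++ _).
by rewrite drop_cat size_wtake ltnn subnn drop0.
Qed.

Hypothesis w_gt0 : 0 < pi_word R w.
Hypothesis b_itv : 0 < b <= 1.

(** On words with suffix w_k, p_i splits as p_i(w_k) times its left part. The mean of the left part
    is near b^i p_i(w) / p_i(w_k), which tends to b^i as p_i(w) is nonzero, and the left part
    differs from T^i by at most i^2 / |w_k|. *)
Lemma left_ratio_moment (i : nat) (e : R) : (4 <= i)%N -> avoids w i -> 0 < e ->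
  exists K, forall k, (K <= k)%N -> exists n0, forall n, (n0 <= n)%N ->
    `|avg n (fun v => ends_as k v * left_ratio k v ^+ i) - b ^+ i| <= e.
Proof.
move=> i4 wi e0; have /andP[b0 b1] := b_itv.
pose P := prod_g R w i; pose p k : R := twos_ratio (wtake w k) i%:R.
have P0 : P != 0 by exact: prod_g_neq0.
have p0 k : p k != 0 by exact: twos_ratio_wtake_neq0.
have e3 : 0 < e / 3 by lra.
have c1 : b ^+ i * P * (p k)^-1 @[k --> \oo] --> b ^+ i.
  have {2}-> : b ^+ i = b ^+ i * P * P^-1 by rewrite mulfK.
  by apply: cvgMl_tmp; apply: cvgV => //; exact: cvg_twos_ratio.
have c2 : i%:R ^+ 2 * (rank (wtake w k))%:R^-1 @[k --> \oo] --> (0 : R).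
  by rewrite -(mulr0 (i%:R ^+ 2)); apply: cvgMl_tmp; exact: cvg_rank_inv.
have [K1 _ K1P] := cvgr_dist_le _ _ c1 _ e3.
have [K2 _ K2P] := cvgr_dist_le _ _ c2 _ e3.
exists (maxn i (maxn K1 K2)) => k; rewrite !geq_max => /and3P[ik kK1 kK2].
have [C C0 CP] := suffix_average k i4.
(* Chosen after k, since both the constant [C] and [p k] depend on the suffix. *)
pose n0 := Num.bound (C / (`|p k| * (e / 3))); exists n0 => n nn.
set N := rank (wtake w k).
have kN : (k <= N)%N := leq_rank_wtake w k.
have iN : (i <= N)%N by rewrite (leq_trans ik).
have N0 : (0 < N)%N by rewrite (leq_trans _ iN) // (leq_trans _ i4).
have a0 : 0 < `|p k| by rewrite normr_gt0.
pose T v : R := twos_ratio_tail N (drop k v) i%:R.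
have -> : avg n (fun v => ends_as k v * left_ratio k v ^+ i) - b ^+ i =
    avg n (fun v => ends_as k v * (left_ratio k v ^+ i - T v)) +
    ((avg n (fun v => ends_as k v * T v) - b ^+ i * P * (p k)^-1) +
     (b ^+ i * P * (p k)^-1 - b ^+ i)).
  rewrite (_ : avg n _ = avg n (fun v => ends_as k v * (left_ratio k v ^+ i - T v)) +
    avg n (fun v => ends_as k v * T v)); first by ring.
  by rewrite -avgD; apply: eq_avg => v _; ring.
have -> : e = e / 3 + (e / 3 + e / 3) by field.
rewrite (le_trans (ler_normD _ _)) // lerD //.
  rewrite ger0_norm; last first.
    apply: avg_ge0 => v _; rewrite mulr_ge0 ?ler0n // subr_ge0.
    by have [] := twos_ratio_tail_power R (drop k v) N0 iN.
  have := K2P _ kK2; rewrite sub0r normrN ger0_norm; last first.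
    by rewrite mulr_ge0 ?sqr_ge0 ?invr_ge0.
  apply: le_trans.
  apply: (@le_trans _ _ (avg n (fun=> i%:R ^+ 2 * N%:R^-1 * 1))); last first.
    by rewrite avgZ avg1 mulr1.
  apply: le_avg => v _.
  rewrite mulr1 /ends_as; case: (prefix _ _); last by rewrite mul0r mulr_ge0 ?sqr_ge0 ?invr_ge0.
  have [_ _ _ _ TT] := twos_ratio_tail_power R (drop k v) N0 iN.
  by rewrite mul1r (le_trans TT) // ler_wpM2l ?sqr_ge0 // gerBl invr_ge0.
rewrite (le_trans (ler_normD _ _)) // lerD //; last first.
  by rewrite distrC; exact: K1P.
have -> : avg n (fun v => ends_as k v * T v) =
    (\sum_(v <- words n) phi v * twos_prod_suffix (wtake w k) i%:R v) * (p k)^-1.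
  rewrite mulr_suml; apply: eq_bigr => v _; rewrite /ends_as /twos_prod_suffix.
  case: ifP => pv; last by rewrite mul0r !mulr0 mul0r.
  have q0 : twos_prod v 0 != 0 :> R by rewrite gt_eqF ?twos_prod_gt0.
  have -> : twos_prod v i%:R = twos_prod v 0 * (p k * T v).
    by rewrite /p /T -twos_ratio_cat -ends_as_split // /twos_ratio mulrC divfK.
  by rewrite mul1r; field.
rewrite -mulrBl normrM normfV ler_pdivrMr //; apply: le_trans (CP n) _.
rewrite ler_pdivrMr ?ltr0n // mulrC -ler_pdivrMr ?mulr_gt0 //.
rewrite [_ / 3 * _]mulrC.
have := archi_boundP (_ : 0 <= C / (`|p k| * (e / 3))).
move=> /(_ (divr_ge0 C0 (ltW (mulr_gt0 a0 e3)))) /ltW /le_trans; apply.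
by rewrite ler_nat (leq_trans nn).
Qed.

Lemma ends_as_itv k v : 0 <= ends_as k v <= 1.
Proof. by rewrite /ends_as ler0n lern1 leq_b1. Qed.

Lemma left_ratio_itv k v : (0 < k)%N -> 0 <= left_ratio k v <= 1.
Proof.
move=> k0; have N0 : (0 < rank (wtake w k))%N by rewrite (leq_trans k0) ?leq_rank_wtake.
by have [_ _ -> -> _] := twos_ratio_tail_power R (drop k v) N0 N0.
Qed.

(* Two moments of [left_ratio] with the values of the constant b force it to be
   close to b, by the strict convexity expressed in [power_gap]. *)
Lemma suffix_concentration (e : R) : 0 < e ->
  exists K, forall k, (K <= k)%N -> exists n0, forall n, (n0 <= n)%N ->
    1 - avg n (ends_as k) <= e /\
    avg n (fun v => ends_as k v * (left_ratio k v / b - 1) ^+ 2) <= e.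
Proof.
move=> e0; have /andP[b0 b1] := b_itv.
(* One of 4, 5 and one of 6, 7 is avoided. *)
have [i [j [i4 ij wi wj]]] : exists i j, [/\ (4 <= i)%N, (i < j)%N, avoids w i & avoids w j].
  by case: (avoids_succ w 4) => wi; case: (avoids_succ w 6) => wj;
     [exists 4, 6|exists 4, 7|exists 5, 6|exists 5, 7].
have i0 : (0 < i)%N by rewrite (leq_trans _ i4).
have ij' : (0 < i < j)%N by rewrite i0.
have iR : 0 < i%:R :> R by rewrite ltr0n.
have jR : 0 < j%:R :> R by rewrite ltr0n (leq_trans _ ij).
pose c : R := i%:R^-1 - j%:R^-1; pose s : R := (i%:R * i.+1%:R)^-1.
have c0 : 0 < c by rewrite subr_gt0 ltf_pV2 ?posrE // ltr_nat.
have s0 : 0 < s by rewrite invr_gt0 mulr_gt0 // ltr0n.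
pose Bi : R := (b ^+ i * i%:R)^-1; pose Bj : R := (b ^+ j * j%:R)^-1.
have Bi0 : 0 < Bi by rewrite invr_gt0 mulr_gt0 // exprn_gt0.
have Bj0 : 0 < Bj by rewrite invr_gt0 mulr_gt0 // exprn_gt0.
pose r : R := Num.min c s.
have r0 : 0 < r by rewrite lt_min c0 s0.
have rc : r <= c by rewrite ge_min lexx.
have rs : r <= s by rewrite ge_min lexx orbT.
(* Moment errors of this size, weighted by [Bi] and [Bj], add up to e r; as r is at most [c] and
   [s], both conclusions follow from one inequality. *)
have d0 : 0 < e * r / (Bi + Bj) by rewrite divr_gt0 ?mulr_gt0 ?addr_gt0.
have [Ki KiP] := left_ratio_moment i4 wi d0.
have [Kj KjP] := left_ratio_moment (leq_trans i4 (ltnW ij)) wj d0.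
exists (maxn 1 (maxn Ki Kj)) => k; rewrite !geq_max => /and3P[k0 kKi kKj].
have [ni niP] := KiP k kKi; have [nj njP] := KjP k kKj.
exists (maxn ni nj) => n; rewrite geq_max => /andP[/niP mi /njP mj].
set A := avg n (ends_as k); set X := avg n (fun v => _ * (_ - 1) ^+ 2).
have A1 : A <= 1.
  by rewrite -(avg1 n); apply: le_avg => v _; case/andP: (ends_as_itv k v).
have X0 : 0 <= X.
  by apply: avg_ge0 => v _; rewrite mulr_ge0 ?sqr_ge0 //; case/andP: (ends_as_itv k v).
have key : s * X <= Bj * avg n (fun v => ends_as k v * left_ratio k v ^+ j) +
    (- Bi * avg n (fun v => ends_as k v * left_ratio k v ^+ i) + c * A).
  rewrite /X /A -!avgZ -!avgD; apply: le_avg => v _.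
  have /andP[a0 _] := ends_as_itv k v; have /andP[t0 _] := left_ratio_itv v k0.
  have /(power_gap (t := left_ratio k v / b)) := ij'; rewrite divr_ge0 ?(ltW b0) //.
  move=> /(_ isT) /(ler_wpM2l a0) H; rewrite mulrCA [s * _]mulrC.
  apply: le_trans H _; rewrite le_eqVlt; apply/orP; left; apply/eqP.
  move: (left_ratio k v) => t; rewrite !expr_div_n /Bi /Bj /c; field.
  by rewrite !gt_eqF ?exprn_gt0.
(* With exact moments b^i and b^j the right side of [key] would be 1/j - 1/i + c A = - c (1 - A), so
   that the missing mass and the spread both appear on the left. *)
have bound : s * X + c * (1 - A) <= e * r.
  have hj : Bj * avg n (fun v => ends_as k v * left_ratio k v ^+ j) <=
      j%:R^-1 + Bj * (e * r / (Bi + Bj)).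
    have -> : j%:R^-1 = Bj * b ^+ j.
      by rewrite /Bj; field; rewrite !gt_eqF ?exprn_gt0.
    rewrite -mulrDr ler_wpM2l ?(ltW Bj0) //.
    by move: mj; rewrite ler_norml => /andP[_ mj]; lra.
  have hi : - Bi * avg n (fun v => ends_as k v * left_ratio k v ^+ i) <=
      - i%:R^-1 + Bi * (e * r / (Bi + Bj)).
    have -> : - i%:R^-1 = Bi * - b ^+ i.
      by rewrite /Bi; field; rewrite !gt_eqF ?exprn_gt0.
    rewrite mulNr -mulrN -mulrDr ler_wpM2l ?(ltW Bi0) //.
    by move: mi; rewrite ler_norml => /andP[mi _]; lra.
  have -> : e * r = Bj * (e * r / (Bi + Bj)) + Bi * (e * r / (Bi + Bj)).
    by field; rewrite gt_eqF // addr_gt0.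
  rewrite -lerBrDr; apply: le_trans key _.
  apply: le_trans (lerD hj (lerD hi (lexx _))) _.
  by rewrite le_eqVlt; apply/orP; left; apply/eqP; rewrite /c; ring.
have cA : 0 <= c * (1 - A) by rewrite mulr_ge0 ?(ltW c0) // subr_ge0.
have sX : 0 <= s * X by rewrite mulr_ge0 ?(ltW s0).
split.
  rewrite -(ler_pM2l c0); apply: (@le_trans _ _ (e * r)); first by lra.
  by rewrite mulrC ler_wpM2r ?(ltW e0).
rewrite -(ler_pM2l s0); apply: (@le_trans _ _ (e * r)); first by lra.
by rewrite mulrC ler_wpM2r ?(ltW e0).
Qed.

Lemma twos_ratio_le v (i : nat) : `|twos_ratio v i%:R : R| <= i%:R ^+ i.
Proof.
case: i => [|i]; first by rewrite twos_ratio0 normr1 expr0.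
apply: le_trans (twos_ratio_pi_fin R v (ltn0Sn i)) _.
have /andP[p0 p1] := pi_fin_itv R v.
apply: (@le_trans _ _ (1 * i.+1%:R ^+ minn (rank v) i.+1)).
  by rewrite ler_wpM2r ?exprn_ge0.
by rewrite mul1r ler_weXn2l ?ler1n // geq_minr.
Qed.

Let M x : R := \sum_(i < (rank x).+1) f_bound R x i * (i%:R ^+ i * (i%:R ^+ 2 + i%:R)).

(** The part of the error of [martin_kernel_gap] that depends on v only through the suffix w_k. *)
Let delta x k : R := M x * (rank (wtake w k))%:R^-1 +
  \sum_(i < (rank x).+1) f_bound R x i * `|twos_ratio (wtake w k) i%:R - prod_g R w i|.

Let f_bound_ge0 x i : 0 <= f_bound R x i.
Proof. exact: sumr_ge0. Qed.

Let M_ge0 x : 0 <= M x.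
Proof.
apply: sumr_ge0 => i _; apply: mulr_ge0; first exact: f_bound_ge0.
apply: mulr_ge0; first exact: exprn_ge0.
by apply: addr_ge0; rewrite ?sqr_ge0.
Qed.

(** The common suffix makes the coefficients f of both sums equal. In each term three errors remain:
    the left part of p_i against T^i, T^i against b^i, and p_i(w_k) against p_i(w). *)
Lemma martin_kernel_gap k x v : (0 < k)%N -> (rank x <= k)%N ->
  (rank x <= rank v)%N -> prefix (wtake w k) v ->
  `|martin_kernel R x v - phi x| <= delta x k + M x * `|left_ratio k v / b - 1|.
Proof.
move=> k0 xk xv pv; have /andP[b0 b1] := b_itv.
set N := rank (wtake w k); set tau := left_ratio k v / b - 1.
have kN : (k <= N)%N := leq_rank_wtake w k.
have N0 : (0 < N)%N by rewrite (leq_trans k0).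
have hx : h x (pad v) = h x w.
  apply: eq_h => j jx; rewrite (ends_as_split pv) pad_wtake //.
  by rewrite (leq_trans jx) // (leq_trans (size_le_rank x)).
rewrite martin_kernelE // hx /phi /d' -sumrB.
apply: le_trans (ler_norm_sum _ _ _) _.
rewrite /delta /M mulr_suml -addrA addrCA addrC mulr_suml -!big_split.
apply: ler_sum => i _ /=.
have iN : (i <= N)%N by rewrite (leq_trans _ kN) // (leq_trans _ xk) // -ltnS.
set F := f R x i _; set p : R := twos_ratio (wtake w k) i%:R; set P := prod_g R w i.
set T := left_ratio k v; pose Ti : R := twos_ratio_tail N (drop k v) i%:R.
have /andP[T0 T1] := left_ratio_itv v k0.
have -> : F * twos_ratio v i%:R - b ^+ i * F * P =
    F * (p * ((Ti - T ^+ i) + (T ^+ i - b ^+ i)) + b ^+ i * (p - P)).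
  have -> : twos_ratio v i%:R = p * Ti by rewrite [in LHS](ends_as_split pv) twos_ratio_cat.
  ring.
rewrite normrM; set B := i%:R ^+ i.
have B0 : 0 <= B by exact: exprn_ge0.
have bound : `|p * ((Ti - T ^+ i) + (T ^+ i - b ^+ i)) + b ^+ i * (p - P)| <=
    `|p - P| + B * (i%:R ^+ 2 + i%:R) * N%:R^-1 + B * (i%:R ^+ 2 + i%:R) * `|tau|.
  rewrite (le_trans (ler_normD _ _)) // [leLHS]addrC -[leRHS]addrA lerD //.
    rewrite normrM (ger0_norm (exprn_ge0 i (ltW b0))).
    by rewrite ler_piMl // exprn_ile1 // ltW.
  rewrite normrM -[_ * _ * N%:R^-1]mulrA -[_ * _ * `|tau|]mulrA -[leRHS]mulrDr.
  rewrite ler_pM ?twos_ratio_le // (le_trans (ler_normD _ _)) // lerD //.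
    have [_ TiT _ _ TT] := twos_ratio_tail_power R (drop k v) N0 iN.
    rewrite distrC ger0_norm ?subr_ge0 //; apply: le_trans TT _.
    apply: (@le_trans _ _ (i%:R ^+ 2 * N%:R^-1)).
      by rewrite ler_wpM2l ?sqr_ge0 // gerBl invr_ge0.
    by rewrite ler_wpM2r ?invr_ge0 // lerDl.
  apply: le_trans (power_lipschitz i _ _) _; first by rewrite T0.
    by rewrite (ltW b0).
  have -> : T - b = b * tau by rewrite /tau -/T; field; rewrite gt_eqF.
  rewrite normrM (ger0_norm (ltW b0)) mulrA ler_wpM2r //.
  by rewrite (le_trans (ler_piMr _ b1)) // lerDr sqr_ge0.
apply: le_trans (ler_pM (normr_ge0 F) (normr_ge0 _) (@f_boundP R x i w) bound) _.
by rewrite le_eqVlt; apply/orP; left; apply/eqP; ring.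
Qed.

Let cvg_delta x : delta x k @[k --> \oo] --> (0 : R).
Proof.
have -> : (0 : R) = M x * 0 + \sum_(i < (rank x).+1) f_bound R x i * `|prod_g R w i - prod_g R w i|.
  by rewrite mulr0 add0r big1 // => i _; rewrite subrr normr0 mulr0.
apply: cvgD; first by apply: cvgMl_tmp; exact: cvg_rank_inv.
apply: cvg_sum_seq => i _; apply: cvgMl_tmp; apply: cvg_norm; apply: cvgB.
  exact: cvg_twos_ratio.
exact: cvg_cst.
Qed.

Lemma boundary_concentrated : concentrated phi.
Proof.
move=> x e e0; have e4 : 0 < e / 4 by lra.
have M1 : 0 < M x + 1 by rewrite ltr_wpDl.
pose z : R := e / 4 / (M x + 1).
have z0 : 0 < z by rewrite divr_gt0.
have Mz : M x * z <= e / 4.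
  by rewrite /z mulrCA ler_piMr ?(ltW e4) // ler_pdivrMr // mul1r lerDl.
(* The final bound has four parts of size e / 4: the missing mass, [delta], M z, and M / z times the
   second moment, for which z^2 is needed. *)
pose eta : R := Num.min (e / 4) (z * z).
have eta0 : 0 < eta by rewrite lt_min e4 mulr_gt0.
have [K KP] := suffix_concentration eta0.
have [K2 _ K2P] := cvgr_dist_le _ _ (@cvg_delta x) _ e4.
pose k := maxn (maxn 1 (rank x)) (maxn K K2).
have k0 : (0 < k)%N by rewrite /k; lia.
have xk : (rank x <= k)%N by rewrite /k; lia.
have [n0 n0P] : exists n0, forall n, (n0 <= n)%N -> 1 - avg n (ends_as k) <= eta /\
    avg n (fun v => ends_as k v * (left_ratio k v / b - 1) ^+ 2) <= eta.
  by apply: KP; rewrite /k; lia.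
have dk : delta x k <= e / 4.
  have := K2P k; rewrite sub0r normrN => H; apply: le_trans (ler_norm _) (H _).
  by rewrite /= /k; lia.
exists (maxn n0 (rank x)); first exact: leq_maxr.
set n := maxn _ _; have [H1 H2] := n0P n (leq_maxl _ _).
have xn : (rank x <= n)%N by exact: leq_maxr.
(* Off the suffix event the deviation is at most 1; on it, |tau| <= z + tau^2 / z for tau = T / b -
   1 brings in the second moment. *)
apply: (@le_trans _ _ (avg n (fun v => (1 + -1 * ends_as k v) + ((delta x k + M x * z) * 1 +
    M x / z * (ends_as k v * (left_ratio k v / b - 1) ^+ 2))))).
  apply: le_avg => v vn; have xv : (rank x <= rank v)%N by rewrite vn.
  have d0 : 0 <= delta x k + M x * z.
    apply: addr_ge0; last by apply: mulr_ge0; [exact: M_ge0|exact: ltW].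
    apply: addr_ge0; first by apply: mulr_ge0; [exact: M_ge0|rewrite invr_ge0].
    by apply: sumr_ge0 => i _; apply: mulr_ge0; first exact: f_bound_ge0.
  case: (boolP (prefix (wtake w k) v)) => pv; last first.
    have -> : ends_as k v = 0 by rewrite /ends_as (negPf pv).
    rewrite mul0r !mulr0 !addr0 mulr1 (@le_trans _ _ 1) //; last by rewrite lerDl.
    have := martin_kernel_itv xv; have := boundary_itv x.
    by rewrite ler_norml => /andP[? ?] /andP[? ?]; apply/andP; split; lra.
  have -> : ends_as k v = 1 by rewrite /ends_as pv.
  rewrite mulN1r subrr add0r mulr1 mul1r.
  apply: le_trans (martin_kernel_gap k0 xk xv pv) _.
  rewrite -[leRHS]addrA lerD2l -[_ / z * _]mulrA -[leRHS]mulrDr ler_wpM2l ?M_ge0 //.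
  set tau := left_ratio k v / b - 1.
  rewrite -(@ler_pM2l _ z) // mulrDr (mulrA z z^-1) mulfV ?gt_eqF // mul1r.
  by rewrite -[tau ^+ 2]real_normK ?num_real //; have := sqr_ge0 (z - `|tau|); nra.
rewrite !avgD !avgZ avg1.
have h1 : M x / z * avg n (fun v => ends_as k v * (left_ratio k v / b - 1) ^+ 2) <= e / 4.
  apply: (@le_trans _ _ (M x / z * (z * z))).
    apply: ler_wpM2l; first by apply: divr_ge0; [exact: M_ge0|exact: ltW].
    rewrite (le_trans H2) //.
    by rewrite ge_min lexx orbT.
  by rewrite mulrA divfK ?gt_eqF.
have h2 : 1 - avg n (ends_as k) <= e / 4 by rewrite (le_trans H1) // ge_min lexx.
lra.
Qed.
End boundary_measures.

Theorem mainTheorem1 (R : realType) :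
  ((exists P : probability path_space R, is_plancherel P) /\
   (forall P : probability path_space R, is_plancherel P -> ergodic P)) /\
  (forall (w : infword) (b : R), 0 < pi_word R w -> 0 < b <= 1 ->
   (exists P : probability path_space R, is_mu w b P) /\
   (forall P : probability path_space R, is_mu w b P -> ergodic P)).
Proof.
split; first by split; [exact: exists_plancherel|exact: plancherel_ergodic].
move=> w b w0 b_itv; have [V [Vw Vp]] := exists_boundary_sequence w b_itv.
have muE (v : word) : mu w b v / (dpaths [::] v)%:R = d' b v w.
  by rewrite /mu mulrAC divff ?mul1r // dpaths_nil gt_eqF ?twos_prod_gt0.
split.
  have [P DP] := exists_distributed_by
    (fun x => proj1 (andP (boundary_itv Vw Vp x)))
    (boundary_harmonic Vw Vp) (boundary_nil Vw Vp).
  exists P; split; first exact: distributed_by_central DP.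
  by move=> s ps; rewrite DP // muE.
move=> P [_ DP]; have DP' : distributed_by (fun x => d' b x w) P.
  by move=> s ps; rewrite DP // muE.
exact: concentrated_ergodic DP' (boundary_concentrated Vw Vp w0 b_itv).
Qed.
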